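(* Let $(M,d,\mu)$ be a metric measure space, with $M$ nonempty and $\mu$ a Borel measure, that admits a heat kernel $\{p_t\}_{t>0}$. Suppose there are positive constants $\alpha,\beta$ and non-negative monotone decreasing functions $\Phi_1,\Phi_2$ on $[0,\infty)$ such that $$\frac{1}{t^{\alpha/\beta}}\,\Phi_1\!\left(\frac{d(x,y)}{t^{1/\beta}}\right)\le p_t(x,y)\le \frac{1}{t^{\alpha/\beta}}\,\Phi_2\!\left(\frac{d(x,y)}{t^{1/\beta}}\right)$$ for $\mu$-a.e. $x,y\in M$ and all $t>0$. Suppose further that $\Phi_1(1)>0$ and that $$\int_0^\infty s^{\alpha+\beta}\,\Phi_2(s)\,\frac{ds}{s}<\infty .$$ Then $W^{\sigma,2}=\{0\}$ for every $\sigma>\beta/2$, and $\beta=\beta^{\ast}$.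
   Context: Heat kernel: a heat kernel on $(M,d,\mu)$ is a family $\{p_t\}_{t>0}$ of symmetric, non-negative, measurable functions $p_t:M\times M\to[0,\infty)$ such that (identities in $x$, $y$ being understood $\mu$-almost everywhere): (i) unit integral: $\int_M p_t(x,y)\,d\mu(y)=1$ for all $t>0$; (ii) semigroup property: $p_{t+s}(x,y)=\int_M p_s(x,z)p_t(z,y)\,d\mu(z)$ for all $s,t>0$; (iii) approximation of the identity: for every $f\in L^2(M,\mu)$, $\int_M p_t(\cdot,y)f(y)\,d\mu(y)\to f$ in $L^2(M,\mu)$ as $t\downarrow 0$. ''Monotone decreasing'' means non-increasing. Besov spaces: $B(x,r)$ denotes the ball of radius $r$ with center $x$. For $\sigma>0$ and $u\in L^2(M,\mu)$ set $$W_\sigma(u)=\sup_{0<r<1} r^{-2\sigma}\int_M \frac{1}{\mu(B(x,r))}\int_{B(x,r)}|u(y)-u(x)|^2\,d\mu(y)\,d\mu(x),$$ and let $W^{\sigma,2}=\{u\in L^2(M,\mu): W_\sigma(u)<\infty\}$, with elements identified when equal $\mu$-a.e. (so $\{0\}$ is the zero subspace of $L^2$). Critical exponent: $\beta^{\ast}=2\sup\{\sigma:\dim W^{\sigma,2}=\infty\}$.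
   Formalization: The measure μ is additionally assumed to be nonzero; for μ = 0 every almost-everywhere condition is vacuous, every W^{σ,2} is {0}, and β = β* fails. *)

(* Defs.v *)
From HB Require Import structures.
From mathcomp Require Import all_boot all_order all_algebra.
From mathcomp Require Import all_classical all_reals all_analysis.

Set Implicit Arguments.
Unset Strict Implicit.
Unset Printing Implicit Defensive.

Import Order.TTheory GRing.Theory Num.Theory.
Import numFieldNormedType.Exports.

Local Open Scope classical_set_scope.
Local Open Scope ring_scope.

(* The point records that the space is nonempty; it plays no other role. *)
#[short(type="pmetricType")]
HB.structure Definition PointedMetric (K : numDomainType) :=
  { M of Pointed M & Metric K M }.

Notation borel M := (g_sigma_algebraType (@open M)).

Section Besov.
Context {R : realType} {M : pmetricType R}.
Variable mu : {measure set (borel M) -> \bar R}.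

(* Square-integrable measurable functions, not yet identified almost
   everywhere. *)
Definition L2 := LfunType mu (lee1n 2).

(* For fixed [t], [P x y] is required for almost every [x], and then for almost
   every [y]: no sigma-finiteness of [mu], hence no product measure, is assumed
   beforehand. *)
Definition ae2 (P : M -> M -> Prop) : Prop :=
  {ae mu, forall x, {ae mu, forall y, P x y}}.

Definition heat_op (k : M -> M -> R) (f : M -> R) (x : M) : R :=
  \int[mu]_y (k x y * f y).

Record heat_kernel (p : R -> M -> M -> R) : Prop := {
  hk_measurable : forall t : R, 0 < t ->
    measurable_fun [set: borel M * borel M] (fun z => p t z.1 z.2);
  hk_ge0 : forall t : R, 0 < t -> forall x y, 0 <= p t x y;
  hk_sym : forall t : R, 0 < t -> ae2 (fun x y => p t x y = p t y x);
  hk_unit : forall t : R, 0 < t ->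
    {ae mu, forall x, \int[mu]_y (p t x y)%:E = 1}%E;
  hk_semigroup : forall s t : R, 0 < s -> 0 < t ->
    ae2 (fun x y => (p (t + s) x y)%:E = \int[mu]_z (p s x z * p t z y)%:E)%E;
  hk_approx_id : forall f : L2,
    ('N[mu]_2%:E[EFin \o (fun x => heat_op (p t) f x - f x)%R])%E
      @[t --> 0^'+] --> 0%E
}.

(* The value is in [0, +oo]. *)
Definition besov_energy (sigma : R) (u : M -> R) : \bar R :=
  ereal_sup [set (r `^ (- (2 * sigma)))%:E *
      \int[mu]_x ((mu (ball (x : M) r))^-1 *
        \int[mu]_(y in ball (x : M) r) (`|u y - u x| ^+ 2)%:E)
    | r in `]0%R, 1%R[ ]%E.

(* The representatives of the elements of $W^{\sigma,2}$. *)
Definition besov (sigma : R) : set L2 :=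
  [set u | besov_energy sigma u < +oo]%E.

(* For a subspace [W] of [L2]: the image of [W] modulo almost everywhere equality
   is infinite-dimensional, i.e. contains linearly independent families of every
   finite length. *)
Definition ae_infinite_dim (W : set L2) : Prop :=
  forall n : nat, exists u : 'I_n -> L2,
    (forall i, W (u i)) /\
    forall c : 'I_n -> R,
      (\sum_(i < n) c i *: u i : L2) = cst 0 %[ae mu] -> forall i, c i = 0.

Definition critical_exponent : \bar R :=
  (2%:E * ereal_sup [set sigma%:E
    | sigma in [set s : R | (0 < s)%R /\ ae_infinite_dim (besov s)]])%E.

End Besov.

Arguments besov {R M} mu sigma.

(* Main.v *)
(* Let P_t be the operator with kernel p_t and E_t(u) = |u|^2 - (u, P_t u), which
   by symmetry and unit mass is half the double integral of
   |u(x) - u(y)|^2 p_t(x,y).  The identity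
   2 E_t - E_{2t} = |u - P_t u|^2 makes E_t(u) / t grow under halving of t.
   If u is in W^{sigma,2} with sigma > beta/2, the upper bound on p_t, cut along
   dyadic distances, gives E_t(u) / t -> 0 as t -> 0; hence E_t(u) = 0 for all t.
   As p_t > 0 on balls of radius t^{1/beta}, u is constant, and it is 0 because
   mu(M) is infinite.
   For beta <= beta^*: t |-> (f, P_t f) = |P_{t/2} f|^2 is bounded, nonnegative and
   midpoint convex, so E_t(P_1 f) <= t |f|^2 at dyadic times, which puts P_1 f in
   W^{beta/2,2}.  The map P_1 is injective on L^2, and L^2 is infinite-dimensional
   because balls have measure comparable to r^alpha. *)
Require Import Defs.
From HB Require Import structures.
From mathcomp Require Import all_boot all_order all_algebra.
From mathcomp Require Import all_classical all_reals all_analysis.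
From mathcomp Require Import measurable_realfun.
From mathcomp Require Import ring lra.

Set Implicit Arguments.
Unset Strict Implicit.
Unset Printing Implicit Defensive.

Import Order.TTheory GRing.Theory Num.Theory.
Import numFieldNormedType.Exports.

Local Open Scope classical_set_scope.
Local Open Scope ring_scope.

(** No separability is assumed, so the distance need not be measurable for the product
    sigma-algebra. Iterated integrals over balls are therefore treated as lower integrals and
    compared through almost everywhere inequalities; Tonelli and Fubini are applied only to
    expressions in the kernels, which are jointly measurable. Sigma-finiteness is itself a
    consequence of the kernel bounds and is established before any product measure is formed.

    The Besov condition controls only scales below 1, whereas the kernel at any time sees all
    distances. Large scales are paid for by the norm of u, and at scale r this costs r^(alpha+beta):
    that is the weight in the moment condition on [Phi2].

    Convexity of t |-> (f, P_t f) stands in for the spectral estimate (1 - e^(-ta)) e^(-2a) <= t. It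
    gives the bound at times 2^-n, which is enough, since any other time is within a factor 2 of one
    of these. *)

Section lower_integral.
Context d (T : measurableType d) (R : realType).
Variable mu : {measure set T -> \bar R}.
Local Open Scope ereal_scope.
Import HBNNSimple.

(* For a non-measurable nonnegative function, the integral is a lower integral. *)
Lemma ae_le_lower_integral (D : set T) (f g : T -> \bar R) :
  (forall x, D x -> 0 <= f x) -> (forall x, D x -> 0 <= g x) ->
  {ae mu, forall x, D x -> f x <= g x} ->
  \int[mu]_(x in D) f x <= \int[mu]_(x in D) g x.
Proof.
move=> f0 g0 [N [mN N0 NS]]; rewrite !ge0_integralE//.
apply: ge_ereal_sup => /= _ [h hf <-].
(* Cutting a simple function below [f] to zero on the null set where the comparison may fail leaves
   its integral unchanged and puts it below [g] everywhere. *)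
pose h' := proj_nnsfun h (measurableC mN).
have h'E x : h' x = (h x * \1_(~` N) x)%R by [].
have -> : sintegral mu h = sintegral mu h'.
  rewrite -!integralT_nnsfun; apply: ae_eq_integral => //.
  - exact/measurable_EFinP.
  - exact/measurable_EFinP.
  - exists N; split => // x; apply: contra_notP => Nx _.
    by congr EFin; rewrite h'E indicE mem_set ?mulr1.
apply: le_ereal_sup_tmp; exists (sintegral mu h') => //; exists h' => // x.
change ((h' x)%:E <= (g \_ D) x).
rewrite h'E indicE; have [Nx|Nx] := pselect (N x).
  by rewrite memNset ?mulr0//= ?erestrict_ge0//; apply.
rewrite mem_set//= mulr1; apply: (le_trans (hf x)).
rewrite /patch; case: ifPn => // /set_mem Dx.
by have := contra_notP (NS x) Nx; exact.
Qed.

End lower_integral.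

(** * The inner product of L^2 *)

HB.lock Definition dot d (T : measurableType d) (R : realType)
  (mu : {measure set T -> \bar R}) (f g : T -> R) : R := \int[mu]_x (f x * g x).

Section square_integrable.
Context d (T : measurableType d) (R : realType).
Variable mu : {measure set T -> \bar R}.
Implicit Types f g h : T -> R.
Local Notation dot := (dot mu).

Lemma Lfun2P f : f \in Lfun mu 2%:E <->
  measurable_fun setT f /\ (\int[mu]_x (f x ^+ 2)%:E < +oo)%E.
Proof.
split=> [fL|[mf fi]].
  split; last by have /integrable_lty := Lfun2_integrable_sqr fL; exact.
  by have /andP[/[!inE]/=] := fL.
rewrite inE; apply/andP; split; rewrite inE//= /finite_norm unlock /=.
apply: poweR_lty.
under eq_integral do rewrite /= powR_mulrn// -normrX ger0_norm ?sqr_ge0//.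
exact: fi.
Qed.

Lemma Lfun2_measurable f : f \in Lfun mu 2%:E -> measurable_fun setT f.
Proof. by move=> /Lfun2P[]. Qed.

Lemma Lfun2_lincomb (a : R) f g : f \in Lfun mu 2%:E -> g \in Lfun mu 2%:E ->
  (fun x => a * f x + g x) \in Lfun mu 2%:E.
Proof. by move=> fL gL; have [_] := Lfun_submod_closed mu (lee1n 2); exact. Qed.

Lemma Lfun2_sum (I : Type) (s : seq I) (c : I -> R) (f : I -> T -> R) :
  (forall i, f i \in Lfun mu 2%:E) ->
  (fun x => \sum_(i <- s) c i * f i x) \in Lfun mu 2%:E.
Proof.
move=> fL; elim: s => [|i s ih].
  apply/Lfun2P; under eq_fun do rewrite big_nil; split=> //.
  by under eq_integral do rewrite big_nil expr0n; rewrite integral0 ltry.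
by under eq_fun do rewrite big_cons; exact: Lfun2_lincomb.
Qed.

Lemma integrable_dot f g : f \in Lfun mu 2%:E -> g \in Lfun mu 2%:E ->
  mu.-integrable setT (EFin \o (f \* g)).
Proof. by move=> fL gL; apply/Lfun1_integrable/Lfun2_mul_Lfun1. Qed.

Lemma dotC f g : dot f g = dot g f.
Proof. by rewrite dot.unlock; apply: eq_Rintegral => x _; rewrite mulrC. Qed.

Lemma dot_ge0 f : 0 <= dot f f.
Proof.
by rewrite dot.unlock; apply: Rintegral_ge0 => x _; rewrite -expr2 sqr_ge0.
Qed.

Lemma EFin_dot f : f \in Lfun mu 2%:E ->
  (dot f f)%:E = (\int[mu]_x (f x ^+ 2)%:E)%E.
Proof.
move=> fL; rewrite dot.unlock /Rintegral fineK.
  by apply: eq_integral => x _; rewrite expr2.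
exact/integrable_fin_num/integrable_dot.
Qed.

Lemma dotBl f g h : f \in Lfun mu 2%:E -> g \in Lfun mu 2%:E ->
  h \in Lfun mu 2%:E -> dot (f - g) h = dot f h - dot g h.
Proof.
move=> fL gL hL; rewrite dot.unlock -RintegralB//; try exact: integrable_dot.
by apply: eq_Rintegral => x _; rewrite mulrBl.
Qed.

Lemma dot_sqrB f g : f \in Lfun mu 2%:E -> g \in Lfun mu 2%:E ->
  dot (f - g) (f - g) = dot f f - 2 * dot f g + dot g g.
Proof.
move=> fL gL; have fgL : f - g \in Lfun mu 2%:E.
  by rewrite rpredB// lee1n.
rewrite dotBl// ![dot _ (f - g)]dotC !dotBl// (dotC g f); ring.
Qed.

Lemma ae_eq_dot f f' g : f \in Lfun mu 2%:E -> f' \in Lfun mu 2%:E ->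
  g \in Lfun mu 2%:E -> f = f' %[ae mu] -> dot f g = dot f' g.
Proof.
move=> fL f'L gL ff'; rewrite dot.unlock; congr fine.
apply: ae_eq_integral => //.
- exact: (measurable_int _ (integrable_dot fL gL)).
- exact: (measurable_int _ (integrable_dot f'L gL)).
- by apply: filterS ff' => x fx _; rewrite fx.
Qed.

Lemma dot_eq0 f : f \in Lfun mu 2%:E -> dot f f = 0 -> f = cst 0 %[ae mu].
Proof.
move=> fL ff0; have := EFin_dot fL; rewrite ff0 => /esym.
have mf2 : measurable_fun setT (fun x => (f x ^+ 2)%:E).
  exact/measurable_EFinP/measurable_funX/Lfun2_measurable.
have [+ _] := ae_eq_integral_abs mu measurableT mf2.
under eq_integral do rewrite gee0_abs ?lee_fin ?sqr_ge0//.
move=> /[apply]; apply: filterS => x /= /(_ I)[] /eqP.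
by rewrite sqrf_eq0 => /eqP.
Qed.

End square_integrable.

(** * Symmetric Markov kernels and their semigroups *)

HB.lock Definition kernel_op d (T : measurableType d) (R : realType)
  (mu : {measure set T -> \bar R}) (k : T -> T -> R) (f : T -> R) (x : T) : R :=
  \int[mu]_y (k x y * f y).

Lemma kernel_opE d (T : measurableType d) (R : realType)
    (mu : {measure set T -> \bar R}) (k : T -> T -> R) (f : T -> R) (x : T) :
  kernel_op mu k f x = \int[mu]_y (k x y * f y).
Proof. by rewrite kernel_op.unlock. Qed.

Section markov_kernel.
Context d (T : measurableType d) (R : realType).
Variable mu : {sigma_finite_measure set T -> \bar R}.

Record symmetric_markov (k : T -> T -> R) : Prop := SymmetricMarkov {
  markov_measurable : measurable_fun setT (fun z : T * T => k z.1 z.2);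
  markov_ge0 : forall x y, 0 <= k x y;
  markov_sym : {ae mu, forall x, {ae mu, forall y, k x y = k y x}};
  markov_int1 : {ae mu, forall x, (\int[mu]_y (k x y)%:E = 1)%E} }.

Variables (k : T -> T -> R) (hk : symmetric_markov k).
Implicit Types f g u : T -> R.

Let mk := markov_measurable hk.
Let k0 := markov_ge0 hk.

Lemma markov_measurable1 x : measurable_fun setT (k x).
Proof. exact: measurableT_comp mk (pair1_measurable x). Qed.

Lemma markov_measurable2 y : measurable_fun setT (k ^~ y).
Proof. exact: measurableT_comp mk (pair2_measurable y). Qed.

Let mk1 := markov_measurable1.
Let mk2 := markov_measurable2.

Lemma markov_marginal1 (g : T -> \bar R) : measurable_fun setT g ->
  (forall x, 0 <= g x)%E ->
  (\int[mu]_x \int[mu]_y ((k x y)%:E * g x) = \int[mu]_x g x)%E.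
Proof.
move=> mg g0; have mF : measurable_fun setT
    (fun x => (\int[mu]_y ((k x y)%:E * g x))%E).
  apply: (measurable_fun_fubini_tonelli_F (fun z => (k z.1 z.2)%:E * g z.1)%E).
    by apply: emeasurable_funM;
      [exact/measurable_EFinP|exact: measurableT_comp].
  by move=> z; rewrite mule_ge0// lee_fin k0.
apply: ae_eq_integral => //; apply: filterS (markov_int1 hk) => x kx _.
rewrite ge0_integralZr//; last 2 first.
- exact/measurable_EFinP.
- by move=> y _; rewrite lee_fin k0.
by rewrite kx mul1e.
Qed.

(** Invariance of [mu]: Tonelli exchanges the integrals, and almost everywhere symmetry reduces to
    the unit mass in the other variable. *)
Lemma markov_marginal2 (g : T -> \bar R) : measurable_fun setT g ->
  (forall x, 0 <= g x)%E ->
  (\int[mu]_x \int[mu]_y ((k x y)%:E * g y) = \int[mu]_x g x)%E.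
Proof.
move=> mg g0; rewrite -(markov_marginal1 mg g0).
have mF : measurable_fun setT (fun z : T * T => ((k z.1 z.2)%:E * g z.1)%E).
  by apply: emeasurable_funM; [exact/measurable_EFinP|exact: measurableT_comp].
have mG : measurable_fun setT (fun z : T * T => ((k z.1 z.2)%:E * g z.2)%E).
  by apply: emeasurable_funM; [exact/measurable_EFinP|exact: measurableT_comp].
have G0 (z : T * T) : (0 <= (k z.1 z.2)%:E * g z.2)%E.
  by rewrite mule_ge0// lee_fin k0.
etransitivity; first exact: (fubini_tonelli _ mG G0).
apply: ae_eq_integral => //.
- apply: (measurable_fun_fubini_tonelli_G _ mG).
  by move=> z; rewrite mule_ge0// lee_fin k0.
- apply: (measurable_fun_fubini_tonelli_F _ mF).
  by move=> z; rewrite mule_ge0// lee_fin k0.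
apply: filterS (markov_sym hk) => y ky _; apply: ae_eq_integral => //.
- by apply: emeasurable_funM => /=; [exact/measurable_EFinP/mk2|
    exact: measurable_cst].
- by apply: emeasurable_funM => /=; [exact/measurable_EFinP/mk1|
    exact: measurable_cst].
- by apply: filterS ky => x -> _.
Qed.

Lemma markov_sq_integrable f : f \in Lfun mu 2%:E ->
  {ae mu, forall x, mu.-integrable setT (EFin \o (fun y => k x y * f y ^+ 2))}.
Proof.
move=> fL; have [mf fi] := (Lfun2P mu f).1 fL.
have mf2 : measurable_fun setT (fun x => (f x ^+ 2)%:E).
  exact/measurable_EFinP/measurable_funX.
apply: (@ae_integrable1 _ _ _ _ _ mu mu
  (fun z => (k z.1 z.2 * f z.2 ^+ 2)%:E)).
have mF : measurable_fun setT (fun z : T * T => (k z.1 z.2 * f z.2 ^+ 2)%:E).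
  apply/measurable_EFinP/measurable_funM => //.
  exact/measurable_funX/measurableT_comp.
apply/integrable12ltyP => //; apply: le_lt_trans fi.
have f20 x : (0 <= (f x ^+ 2)%:E)%E by rewrite lee_fin sqr_ge0.
rewrite -(markov_marginal2 mf2 f20).
rewrite le_eqVlt; apply/orP; left; apply/eqP.
apply: eq_integral => x _; apply: eq_integral => y _.
by rewrite gee0_abs ?EFinM// lee_fin mulr_ge0 ?sqr_ge0.
Qed.

Lemma markov_integrable1 :
  {ae mu, forall x, mu.-integrable setT (EFin \o k x)}.
Proof.
apply: filterS (markov_int1 hk) => x kx; apply/integrableP; split.
  exact/measurable_EFinP.
under eq_integral do rewrite /= ger0_norm//.
by rewrite kx ltry.
Qed.

(** Since |f| <= 1 + f^2, the integrand is dominated by k + k f^2, both integrable for almost every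
    x. *)
Lemma markov_integrable f : f \in Lfun mu 2%:E ->
  {ae mu, forall x, mu.-integrable setT (EFin \o (fun y => k x y * f y))}.
Proof.
move=> fL; apply: filterS2 markov_integrable1 (markov_sq_integrable fL).
move=> x k1 k2.
have k12 := integrableD measurableT k1 k2.
apply: (le_integrable measurableT _ _ k12).
  apply/measurable_EFinP/measurable_funM; first exact: mk1.
  exact: Lfun2_measurable fL.
move=> y _ /=; rewrite lee_fin normrM (ger0_norm (k0 x y)).
rewrite [leRHS]ger0_norm ?addr_ge0 ?(mulr_ge0 _ (sqr_ge0 _))//.
rewrite -[X in _ <= X + _]mulr1 -mulrDr ler_wpM2l//.
rewrite -(real_normK (num_real (f y))).
have := normr_ge0 (f y); set a := `|f y|; nra.
Qed.

Lemma kernel_op_measurable f : measurable_fun setT f ->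
  measurable_fun setT (kernel_op mu k f).
Proof.
move=> mf; have mF : measurable_fun setT
    (fun z : T * T => (k z.1 z.2 * f z.2)%:E).
  by apply/measurable_EFinP/measurable_funM => //; exact: measurableT_comp.
rewrite kernel_op.unlock; apply: measurableT_comp => //.
under eq_fun do rewrite integralE.
apply: emeasurable_funB.
- have mP := 
    measurable_fun_fubini_tonelli_F (m2 := mu) _ (measurable_funepos mF).
  apply: eq_measurable_fun (mP (fun z => funepos_ge0 _ z)) => x _.
  by apply: eq_integral => y _; rewrite !funeposE.
- have mN := 
    measurable_fun_fubini_tonelli_F (m2 := mu) _ (measurable_funeneg mF).
  apply: eq_measurable_fun (mN (fun z => funeneg_ge0 _ z)) => x _.
  by apply: eq_integral => y _; rewrite !funenegE.
Qed.

Lemma kernel_op_sum (I : Type) (s : seq I) (c : I -> R) (f : I -> T -> R) :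
  (forall i, f i \in Lfun mu 2%:E) ->
  {ae mu, forall x, kernel_op mu k (fun y => \sum_(i <- s) c i * f i y) x =
    \sum_(i <- s) c i * kernel_op mu k (f i) x}.
Proof.
move=> fL; elim: s => [|i s ih].
  apply: aeW => x; rewrite big_nil kernel_opE.
  by under eq_Rintegral do rewrite big_nil mulr0; rewrite Rintegral_cst// mul0r.
apply: filterS3 ih (markov_integrable (fL i))
  (markov_integrable (Lfun2_sum s c fL)) => x ih ii is_.
rewrite big_cons -ih !kernel_opE -RintegralZl// -RintegralD//.
  by apply: eq_Rintegral => y _; rewrite big_cons mulrDr mulrCA.
exact: (integrableZl measurableT (c i) ii).
Qed.

(* Jensen's inequality for the probability density [k x]. *)
Lemma kernel_op_sq_le f : f \in Lfun mu 2%:E ->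
  {ae mu, forall x, ((kernel_op mu k f x ^+ 2)%:E <=
    \int[mu]_y ((k x y)%:E * (f y ^+ 2)%:E))%E}.
Proof.
move=> fL.
apply: filterS (filterI (filterI (markov_int1 hk) markov_integrable1)
  (filterI (markov_integrable fL) (markov_sq_integrable fL))).
move=> x [[kx1 kxi] [kfi kf2i]]; set c := kernel_op mu k f x.
have kx1' : \int[mu]_y k x y = 1 by rewrite /Rintegral kx1.
have -> : (\int[mu]_y ((k x y)%:E * (f y ^+ 2)%:E) =
    (\int[mu]_y (k x y * f y ^+ 2))%R%:E)%E.
  rewrite /Rintegral fineK//; exact: integrable_fin_num kf2i.
rewrite lee_fin.
have i1 : mu.-integrable setT (EFin \o (fun y => (2 * c) * (k x y * f y))).
  exact: (integrableZl measurableT (2 * c) kfi).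
have i2 : mu.-integrable setT (EFin \o (fun y => c ^+ 2 * k x y)).
  exact: (integrableZl measurableT (c ^+ 2) kxi).
have i3 : mu.-integrable setT
    (EFin \o (fun y => k x y * f y ^+ 2 - (2 * c) * (k x y * f y))).
  exact: (integrableB measurableT kf2i i1).
(* The variance of [f] under the density [k x], expanded around its mean [c]. *)
have : 0 <= \int[mu]_y (k x y * f y ^+ 2 - (2 * c) * (k x y * f y)
    + c ^+ 2 * k x y).
  apply: Rintegral_ge0 => y _.
  rewrite [leRHS](_ : _ = k x y * (f y - c) ^+ 2); last by ring.
  by rewrite mulr_ge0 ?sqr_ge0.
rewrite RintegralD// RintegralB// !RintegralZl// kx1'.
have -> : \int[mu]_y (k x y * f y) = c by rewrite /c kernel_opE.
by lra.
Qed.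

Let int_kernel_op_sq_le f : f \in Lfun mu 2%:E ->
  (\int[mu]_x (kernel_op mu k f x ^+ 2)%:E <= \int[mu]_x (f x ^+ 2)%:E)%E.
Proof.
move=> fL; have mf2 : measurable_fun setT (fun x => (f x ^+ 2)%:E).
  exact/measurable_EFinP/measurable_funX/(Lfun2_measurable fL).
have f20 x : (0 <= (f x ^+ 2)%:E)%E by rewrite lee_fin sqr_ge0.
rewrite -(markov_marginal2 mf2 f20); apply: ae_le_lower_integral => //.
- by move=> x _; rewrite lee_fin sqr_ge0.
- by move=> x _; apply: integral_ge0 => y _; rewrite mule_ge0// lee_fin.
- by apply: filterS (kernel_op_sq_le fL) => x.
Qed.

Lemma kernel_op_Lfun f :
  f \in Lfun mu 2%:E -> kernel_op mu k f \in Lfun mu 2%:E.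
Proof.
move=> fL; have [mf fi] := (Lfun2P mu f).1 fL.
apply/Lfun2P; split; first exact: kernel_op_measurable.
exact: le_lt_trans (int_kernel_op_sq_le fL) fi.
Qed.

Lemma kernel_op_contraction f : f \in Lfun mu 2%:E ->
  dot mu (kernel_op mu k f) (kernel_op mu k f) <= dot mu f f.
Proof.
move=> fL; rewrite -lee_fin !EFin_dot//; last exact: kernel_op_Lfun.
exact: int_kernel_op_sq_le.
Qed.

Let integrable_kernel_sq1 f : f \in Lfun mu 2%:E ->
  (mu \x mu)%E.-integrable setT (EFin \o (fun z => k z.1 z.2 * f z.1 ^+ 2)).
Proof.
move=> fL; have [mf fi] := (Lfun2P mu f).1 fL.
have mf2 : measurable_fun setT (fun x => (f x ^+ 2)%:E).
  exact/measurable_EFinP/measurable_funX.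
have f20 x : (0 <= (f x ^+ 2)%:E)%E by rewrite lee_fin sqr_ge0.
apply/integrable12ltyP.
  apply/measurable_EFinP/measurable_funM => //.
  exact/measurable_funX/measurableT_comp.
apply: le_lt_trans fi; rewrite -(markov_marginal1 mf2 f20).
rewrite le_eqVlt; apply/orP; left; apply/eqP.
apply: eq_integral => x _; apply: eq_integral => y _.
by rewrite /= ger0_norm ?EFinM// mulr_ge0 ?sqr_ge0.
Qed.

Let integrable_kernel_sq2 f : f \in Lfun mu 2%:E ->
  (mu \x mu)%E.-integrable setT (EFin \o (fun z => k z.1 z.2 * f z.2 ^+ 2)).
Proof.
move=> fL; have [mf fi] := (Lfun2P mu f).1 fL.
have mf2 : measurable_fun setT (fun x => (f x ^+ 2)%:E).
  exact/measurable_EFinP/measurable_funX.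
have f20 x : (0 <= (f x ^+ 2)%:E)%E by rewrite lee_fin sqr_ge0.
apply/integrable12ltyP.
  apply/measurable_EFinP/measurable_funM => //.
  exact/measurable_funX/measurableT_comp.
apply: le_lt_trans fi; rewrite -(markov_marginal2 mf2 f20).
rewrite le_eqVlt; apply/orP; left; apply/eqP.
apply: eq_integral => x _; apply: eq_integral => y _.
by rewrite /= ger0_norm ?EFinM// mulr_ge0 ?sqr_ge0.
Qed.

(** Domination by k(x,y) (f(x)^2 + g(y)^2) makes Fubini available for the signed bilinear form. *)
Let integrable_kernel_prod f g : f \in Lfun mu 2%:E -> g \in Lfun mu 2%:E ->
  (mu \x mu)%E.-integrable setT
    (EFin \o (fun z => k z.1 z.2 * (f z.1 * g z.2))).
Proof.
move=> fL gL.
have fgi := integrableD measurableT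
  (integrable_kernel_sq1 fL) (integrable_kernel_sq2 gL).
apply: (le_integrable measurableT _ _ fgi).
  apply/measurable_EFinP/measurable_funM => //; apply: measurable_funM.
  - exact: measurableT_comp (Lfun2_measurable fL) measurable_fst.
  - exact: measurableT_comp (Lfun2_measurable gL) measurable_snd.
move=> [x y] _ /=; rewrite normrM (ger0_norm (k0 x y)) lee_fin -mulrDr.
rewrite [leRHS]ger0_norm ?(mulr_ge0 _ (addr_ge0 (sqr_ge0 _) (sqr_ge0 _)))//.
rewrite ler_wpM2l// normrM.
rewrite -(real_normK (num_real (f x))) -(real_normK (num_real (g y))).
have := sqr_ge0 (`|f x| - `|g y|); have := normr_ge0 (f x).
by have := normr_ge0 (g y); set a := `|f x|; set b := `|g y|; nra.
Qed.

Lemma integral_kernel_prod f g : f \in Lfun mu 2%:E -> g \in Lfun mu 2%:E ->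
  (\int[mu]_x \int[mu]_y (k x y * (f x * g y))%:E =
   (dot mu f (kernel_op mu k g))%:E)%E.
Proof.
move=> fL gL; have fgi := integrable_kernel_prod fL gL.
have TgL := kernel_op_Lfun gL; have fTi := integrable_dot fL TgL.
rewrite dot.unlock /Rintegral fineK; last exact: integrable_fin_num.
apply: ae_eq_integral => //.
- exact: (measurable_fubini_F fgi).
- exact: measurable_int fTi.
apply: filterS (markov_integrable gL) => x ki _.
rewrite (eq_integral (fun y => (f x)%:E * (k x y * g y)%:E)%E); last first.
  by move=> y _; rewrite -EFinM mulrCA.
rewrite integralZl// EFinM; congr (_ * _)%E.
by rewrite kernel_opE /Rintegral fineK//; exact: integrable_fin_num ki.
Qed.

Lemma kernel_op_sym f g : f \in Lfun mu 2%:E -> g \in Lfun mu 2%:E ->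
  dot mu (kernel_op mu k f) g = dot mu f (kernel_op mu k g).
Proof.
move=> fL gL; apply: EFin_inj.
rewrite (dotC mu (kernel_op mu k f) g).
rewrite -(integral_kernel_prod gL fL).
rewrite -(integral_kernel_prod fL gL).
have fgi := integrable_kernel_prod fL gL.
have gfi := integrable_kernel_prod gL fL.
rewrite [RHS](Fubini fgi); apply: ae_eq_integral => //.
- exact: (measurable_fubini_F gfi).
- exact: (measurable_fubini_G fgi).
apply: filterS (markov_sym hk) => y ky _; apply: ae_eq_integral => //.
- exact: measurableT_comp (measurable_int _ gfi) (pair1_measurable y).
- exact: measurableT_comp (measurable_int _ fgi) (pair2_measurable y).
by apply: filterS ky => x /= -> _; rewrite [g y * _]mulrC.
Qed.

Lemma kernel_energyE u : u \in Lfun mu 2%:E ->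
  (\int[mu]_x \int[mu]_y (k x y * (u x - u y) ^+ 2)%:E =
   (2 * (dot mu u u - dot mu u (kernel_op mu k u)))%:E)%E.
Proof.
move=> uL.
have i1 := integrable_kernel_sq1 uL; have i2 := integrable_kernel_sq2 uL.
have i3 := integrable_kernel_prod uL uL.
have i12 := integrableD measurableT i1 i2.
have i33 := integrableZl measurableT 2 i3.
have i := integrableB measurableT i12 i33.
have [mu' ui] := (Lfun2P mu u).1 uL.
have mu2 : measurable_fun setT (fun x => (u x ^+ 2)%:E).
  exact/measurable_EFinP/measurable_funX.
have u20 x : (0 <= (u x ^+ 2)%:E)%E by rewrite lee_fin sqr_ge0.
transitivity (\int[mu \x mu]_z
    (((k z.1 z.2 * u z.1 ^+ 2)%:E + (k z.1 z.2 * u z.2 ^+ 2)%:E)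
     - 2%:E * (k z.1 z.2 * (u z.1 * u z.2))%:E))%E.
  rewrite -(integral12_prod_meas1 i) /fubini_F.
  apply: eq_integral => x _; apply: eq_integral => y _ /=.
  by congr EFin; ring.
rewrite (integralB measurableT i12 i33) (integralD measurableT i1 i2).
rewrite (integralZl measurableT i3).
rewrite -(integral12_prod_meas1 i1) -(integral12_prod_meas1 i2).
rewrite -(integral12_prod_meas1 i3) /fubini_F (integral_kernel_prod uL uL).
rewrite [X in (X + _ - _)%E](_ : _ = (dot mu u u)%:E); last first.
  rewrite EFin_dot// -(markov_marginal1 mu2 u20).
  by apply: eq_integral => x _; apply: eq_integral => y _.
rewrite [X in (_ + X - _)%E](_ : _ = (dot mu u u)%:E); last first.
  rewrite EFin_dot// -(markov_marginal2 mu2 u20).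
  by apply: eq_integral => x _; apply: eq_integral => y _.
set a := dot mu u u; set b := dot mu u _.
by have -> : 2 * (a - b) = a + a - 2 * b by ring.
Qed.

End markov_kernel.

(** * Composition of kernels *)

Section kernel_composition.
Context d (T : measurableType d) (R : realType).
Variable mu : {sigma_finite_measure set T -> \bar R}.

(** For almost every fixed x, Fubini applies to a(x,z) b(z,y) f(y) in (z,y): integrating its
    absolute value in z first gives c(x,y) |f(y)|, which is integrable in y. *)
Lemma kernel_op_comp (a b c : T -> T -> R) (f : T -> R) :
  symmetric_markov mu a -> symmetric_markov mu b -> symmetric_markov mu c ->
  {ae mu, forall x, {ae mu, forall y,
    ((c x y)%:E = \int[mu]_z (a x z * b z y)%:E)%E}} ->
  f \in Lfun mu 2%:E ->
  kernel_op mu a (kernel_op mu b f) = kernel_op mu c f %[ae mu].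
Proof.
move=> ha hb hc abc fL.
apply: filterS2 abc (markov_integrable hc fL) => x cx ci _.
have mf := Lfun2_measurable fL.
have ma : measurable_fun setT (a x) := markov_measurable1 ha x.
have a0 := markov_ge0 ha; have b0 := markov_ge0 hb; have c0 := markov_ge0 hc.
have mab : measurable_fun setT (fun z : T * T => a x z.1 * b z.1 z.2).
  by apply: measurable_funM (markov_measurable hb); exact: measurableT_comp.
have mF : measurable_fun setT
    (fun z : T * T => (a x z.1 * (b z.1 z.2 * f z.2))%:E).
  apply/measurable_EFinP/measurable_funM; first exact: measurableT_comp.
  by apply: measurable_funM (markov_measurable hb) _; exact: measurableT_comp.
have iab : {ae mu, forall y,
    mu.-integrable setT (EFin \o (fun z => a x z * b z y))}.
  apply: filterS cx => y cxy; apply/integrableP; split.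
    apply/measurable_EFinP.
    exact: measurableT_comp mab (pair2_measurable y).
  under eq_integral do rewrite /= ger0_norm ?mulr_ge0//.
  by rewrite -cxy ltry.
have iF : (mu \x mu)%E.-integrable setT
    (fun z : T * T => (a x z.1 * (b z.1 z.2 * f z.2))%:E).
  apply/integrable21ltyP => //.
  move/integrableP: (ci) => [_]; apply: le_lt_trans.
  apply: ae_le_lower_integral.
  - by move=> y _; apply: integral_ge0 => z _; rewrite lee_fin.
  - by move=> y _; rewrite lee_fin.
  apply: filterS2 cx iab => y cxy iaby _.
  rewrite (eq_integral (fun z => `|f y|%:E * (a x z * b z y)%:E)%E); last first.
    by move=> z _ /=; rewrite !normrM !(ger0_norm (a0 _ _)) (ger0_norm (b0 _ _))
      -EFinM mulrA mulrC.
  by rewrite integralZl// -cxy /= normrM (ger0_norm (c0 _ _)) mulrC.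
rewrite [LHS]kernel_opE [RHS]kernel_opE /Rintegral; congr fine.
transitivity (\int[mu]_z \int[mu]_y (a x z * (b z y * f y))%:E)%E.
  apply: ae_eq_integral => //.
  - apply/measurable_EFinP/measurable_funM => //.
    exact: (kernel_op_measurable hb).
  - exact: (measurable_fubini_F iF).
  apply: filterS (markov_integrable hb fL) => z bi _.
  transitivity ((a x z)%:E * \int[mu]_y (b z y * f y)%:E)%E.
    by rewrite kernel_opE EFinM fineK//; exact: integrable_fin_num bi.
  by rewrite -integralZl.
rewrite (Fubini iF); apply: ae_eq_integral => //.
- exact: (measurable_fubini_G iF).
- exact: measurable_int ci.
apply: filterS2 cx iab => y cxy iaby _.
rewrite (eq_integral (fun z => (f y)%:E * (a x z * b z y)%:E)%E); last first.
  by move=> z _; rewrite -EFinM /= mulrA mulrC.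
by rewrite integralZl// -cxy -EFinM mulrC.
Qed.

End kernel_composition.

(** * Energy and convexity along a symmetric Markov semigroup *)

Section markov_semigroup.
Context d (T : measurableType d) (R : realType).
Variable mu : {sigma_finite_measure set T -> \bar R}.
Variable p : R -> T -> T -> R.
Hypothesis p_markov : forall t, 0 < t -> symmetric_markov mu (p t).
Hypothesis p_semigroup : forall s t, 0 < s -> 0 < t ->
  {ae mu, forall x, {ae mu, forall y,
    ((p (t + s) x y)%:E = \int[mu]_z (p s x z * p t z y)%:E)%E}}.

Local Notation P t := (kernel_op mu (p t)).
Local Notation dot := (dot mu).
Implicit Types f u : T -> R.

Let P_Lfun t f : 0 < t -> f \in Lfun mu 2%:E -> P t f \in Lfun mu 2%:E.
Proof. by move=> t0; apply: kernel_op_Lfun; exact: p_markov. Qed.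

Lemma semigroup_op s t f : 0 < s -> 0 < t -> f \in Lfun mu 2%:E ->
  P s (P t f) = P (t + s) f %[ae mu].
Proof.
move=> s0 t0 fL; apply: kernel_op_comp => //; try exact: p_markov.
- by apply: p_markov; rewrite addr_gt0.
- exact: p_semigroup.
Qed.

Lemma dot_semigroup s t f : 0 < s -> 0 < t -> f \in Lfun mu 2%:E ->
  dot (P s f) (P t f) = dot f (P (s + t) f).
Proof.
move=> s0 t0 fL; have st0 : 0 < s + t by rewrite addr_gt0.
have PtL := P_Lfun t0 fL; have PsL := P_Lfun s0 PtL; have PstL := P_Lfun st0 fL.
etransitivity; first exact: (kernel_op_sym (p_markov s0) fL PtL).
rewrite dotC [RHS]dotC; apply: ae_eq_dot => //.
by rewrite [s + t]addrC; exact: semigroup_op.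
Qed.

Definition energy t u : R := dot u u - dot u (P t u).

Lemma energy_double s u : 0 < s -> u \in Lfun mu 2%:E ->
  energy (s + s) u <= 2 * energy s u.
Proof.
move=> s0 uL; have PL := P_Lfun s0 uL.
have := dot_ge0 mu (u - P s u); rewrite dot_sqrB//.
by rewrite dot_semigroup// /energy; lra.
Qed.

Lemma energy_expn n s u : 0 < s -> u \in Lfun mu 2%:E ->
  energy (2 ^+ n * s) u <= 2 ^+ n * energy s u.
Proof.
move=> s0 uL; elim: n => [|n ih]; first by rewrite !mul1r.
rewrite exprS -!mulrA mulr_natl mulr2n.
apply: le_trans (energy_double _ uL) _; rewrite ?mulr_gt0 ?exprn_gt0//.
by rewrite ler_pM2l.
Qed.

Let phi f t := dot f (P t f).

Let phi_half f t : 0 < t -> f \in Lfun mu 2%:E ->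
  phi f t = dot (P (t / 2) f) (P (t / 2) f).
Proof.
by move=> t0 fL; rewrite dot_semigroup ?divr_gt0// -splitr.
Qed.

Let phi_ge0 f t : 0 < t -> f \in Lfun mu 2%:E -> 0 <= phi f t.
Proof. by move=> t0 fL; rewrite phi_half// dot_ge0. Qed.

Let phi_le f t : 0 < t -> f \in Lfun mu 2%:E -> phi f t <= dot f f.
Proof.
move=> t0 fL; rewrite phi_half//; apply: kernel_op_contraction => //.
by apply: p_markov; rewrite divr_gt0.
Qed.

Lemma energy_le t u : 0 < t -> u \in Lfun mu 2%:E -> energy t u <= dot u u.
Proof. by move=> t0 uL; rewrite /energy lerBlDr lerDl; exact: phi_ge0. Qed.

Let phi_midconvex f t h : 0 < h -> h < t -> f \in Lfun mu 2%:E ->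
  2 * phi f t <= phi f (t - h) + phi f (t + h).
Proof.
(* With these halved times the three terms of |P_a f - P_b f|^2 >= 0 are the values of [phi f] at t
   - h, t and t + h. *)
move=> h0 ht fL; pose a := (t - h) / 2; pose b := (t + h) / 2.
have a0 : 0 < a by rewrite divr_gt0// subr_gt0.
have b0 : 0 < b by rewrite divr_gt0// addr_gt0// (lt_trans h0).
have := dot_ge0 mu (P a f - P b f); rewrite dot_sqrB; do ?exact: P_Lfun.
rewrite !dot_semigroup// -/(phi f _) -/(phi f _) -/(phi f _).
have -> : a + b = t by rewrite /a /b; lra.
have -> : a + a = t - h by rewrite /a; lra.
have -> : b + b = t + h by rewrite /b; lra.
by lra.
Qed.

(* Midpoint convexity doubles the step of a difference quotient of [phi f]
   without decreasing its absolute value. *)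
Let phi_quotient n f t h :
  0 < h -> (2 ^+ n - 1) * h < t -> f \in Lfun mu 2%:E ->
  phi f t - phi f (t + h) <=
    (2 ^+ n)^-1 * (phi f (t - (2 ^+ n - 1) * h) - phi f (t + h)).
Proof.
elim: n t h => [|n ih] t h h0 ht fL.
  by rewrite expr0 subrr mul0r subr0 invr1 mul1r.
have e1 : 1 <= (2 : R) ^+ n by rewrite exprn_ege1// ler1n.
rewrite exprS in ht *.
have th : h < t by apply: le_lt_trans ht; nra.
have cv := phi_midconvex h0 th fL.
have h20 : 0 < 2 * h by lra.
(* By [cv], the drop of [phi f] over [t, t+h] is at most half its drop over [t-h, t+h]; the latter
   interval has the same right end and a doubled step. *)
have := ih (t - h) (2 * h) h20 _ fL.
have -> : t - h + 2 * h = t + h by ring.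
have -> : t - h - (2 ^+ n - 1) * (2 * h) = t - (2 * 2 ^+ n - 1) * h by ring.
have -> : (2 ^+ n - 1) * (2 * h) < t - h by nra.
move=> /(_ isT); rewrite invfM -mulrA; set X := _^-1 * _ => Xle.
by lra.
Qed.

(** With s = 2^-n the energy of P_1 f is [phi f 2 - phi f (2 + s)]. After n doublings the step
    becomes the interval [1+s, 2+s] of length one, which stays in positive times, and there [phi f]
    lies between 0 and |f|^2. *)
Lemma energy_smoothing n f : f \in Lfun mu 2%:E ->
  energy (2 ^+ n)^-1 (P 1 f) <= (2 ^+ n)^-1 * dot f f.
Proof.
move=> fL; set s := (2 ^+ n)^-1.
have s0 : 0 < s by rewrite invr_gt0 exprn_gt0.
have es : 2 ^+ n * s = 1 by rewrite divff// gt_eqF// exprn_gt0.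
have s1 : 0 < 1 + s by rewrite addr_gt0.
have PL := P_Lfun ltr01 fL.
have -> : energy s (P 1 f) = phi f 2 - phi f (2 + s).
  rewrite /energy dot_semigroup// -/(phi _ _); congr (_ - _).
  rewrite dotC (@ae_eq_dot _ _ _ _ _ (P (1 + s) f)); do ?exact: P_Lfun.
    by rewrite dot_semigroup// -/(phi _ _) addrAC.
  exact: semigroup_op.
have h2 : (2 ^+ n - 1) * s < 2 by rewrite mulrBl es; lra.
apply: le_trans (phi_quotient s0 h2 fL) _; rewrite -/s ler_pM2l//.
rewrite mulrBl es mul1r.
have := @phi_ge0 f (2 + s) _ fL; have := @phi_le f (2 - (1 - s)) _ fL.
have -> : 0 < 2 - (1 - s) by lra.
have -> : 0 < 2 + s by lra.
by move=> /(_ isT) + /(_ isT); lra.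
Qed.

(** A zero propagates to half the time because |P_(t/2) f|^2 = (f, P_t f). *)
Lemma semigroup_op_eq0 n f : f \in Lfun mu 2%:E ->
  P 1 f = cst 0 %[ae mu] -> P (2 ^+ n)^-1 f = cst 0 %[ae mu].
Proof.
move=> fL P1; elim: n => [|n ih]; first by rewrite expr0 invr1.
have s0 : 0 < ((2 : R) ^+ n.+1)^-1 by rewrite invr_gt0 exprn_gt0.
have s1 : 0 < ((2 : R) ^+ n)^-1 by rewrite invr_gt0 exprn_gt0.
have PL := P_Lfun s0 fL.
apply: dot_eq0 => //; rewrite dot_semigroup//.
have -> : ((2 : R) ^+ n.+1)^-1 + (2 ^+ n.+1)^-1 = (2 ^+ n)^-1.
  by rewrite exprS invfM; lra.
have c0 : (cst 0 : T -> R) \in Lfun mu 2%:E.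
  apply/Lfun2P; split=> //; under eq_integral do rewrite expr0n.
  by rewrite integral0 ltry.
have P1L := P_Lfun s1 fL; rewrite dotC (ae_eq_dot P1L c0 fL ih) dot.unlock.
by under eq_Rintegral do rewrite mul0r; rewrite Rintegral_cst// mul0r.
Qed.

End markov_semigroup.

(** * Ball volumes *)

Lemma gt0_powRD {R : realType} (x a b : R) : 0 < x ->
  x `^ (a + b) = x `^ a * x `^ b.
Proof. by move=> x0; rewrite powRD// (gt_eqF x0) /= implybT. Qed.

Section metric_balls.
Context {R : realType} {M : pmetricType R}.
Implicit Types x y : M.

Lemma open_metric_ball x (r : R) : open (ball x r).
Proof.
rewrite openE => y; rewrite ballEmdist /= => xy.
apply/nbhs_ballP; exists (r - mdist x y) => /=; first by rewrite subr_gt0.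
move=> z; rewrite !ballEmdist /= ltrBrDl; apply: le_lt_trans.
exact: metric_triangle.
Qed.

Lemma measurable_metric_ball x (r : R) : measurable (ball x r : set (borel M)).
Proof. by apply: sub_sigma_algebra; exact: open_metric_ball. Qed.

Lemma bigcup_metric_ball x : \bigcup_n ball x n%:R = [set: M].
Proof.
apply/seteqP; split => // y _; have /archi_boundP := mdist_ge0 x y.
by move=> xy; exists (Num.bound (mdist x y)) => //; rewrite ballEmdist.
Qed.

End metric_balls.

Section kernel_bounds.
Context {R : realType} {M : pmetricType R}.
Variable mu : {measure set (borel M) -> \bar R}.
Variables (alpha beta : R) (Phi1 Phi2 : R -> R).
Hypothesis alpha_gt0 : 0 < alpha.
Hypothesis beta_gt0 : 0 < beta.
Hypothesis Phi1_1 : 0 < Phi1 1.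
Hypothesis Phi2_ge0 : forall s : R, 0 <= s -> 0 <= Phi2 s.
Hypothesis Phi1_mono : forall s t : R, 0 <= s -> s <= t -> Phi1 t <= Phi1 s.
Hypothesis Phi2_mono : forall s t : R, 0 <= s -> s <= t -> Phi2 t <= Phi2 s.
(* [q r] is the heat kernel at time [r `^ beta]. *)
Variable q : R -> M -> M -> R.
Hypothesis q_ge0 : forall (r : R) x y, 0 < r -> 0 <= q r x y.
Hypothesis q_int1 : forall r : R, 0 < r ->
  {ae mu, forall x : borel M, \int[mu]_y (q r x y)%:E = 1}%E.
Hypothesis q_bounds : forall r : R, 0 < r ->
  {ae mu, forall x : borel M, {ae mu, forall y : borel M,
    (r `^ alpha)^-1 * Phi1 (mdist x y / r) <= q r x y /\
    q r x y <= (r `^ alpha)^-1 * Phi2 (mdist x y / r)}}.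

Lemma q_lower_ball r s : 0 < r -> s <= r ->
  {ae mu, forall x : borel M, {ae mu, forall y : borel M,
    ball x s y -> (r `^ alpha)^-1 * Phi1 1 <= q r x y}}.
Proof.
move=> r0 sr; apply: filterS (q_bounds r0) => x; apply: filterS => y [+ _].
rewrite ballEmdist /= => + xy; apply: le_trans.
rewrite ler_pM2l ?invr_gt0 ?powR_gt0// Phi1_mono ?divr_ge0 ?mdist_ge0 ?ltW//.
by rewrite ltr_pdivrMr// mul1r (lt_le_trans xy).
Qed.

(** The unit mass of q_r is at least its integral over the ball, where q_r >= r^-alpha [Phi1 1]. *)
Lemma ball_measure_le r : 0 < r ->
  {ae mu, forall x : borel M,
    mu (ball (x : M) r) <= (r `^ alpha / Phi1 1)%:E}%E.
Proof.
move=> r0; have ra0 : 0 < r `^ alpha by rewrite powR_gt0.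
apply: filterS2 (q_int1 r0) (q_lower_ball r0 (lexx r)) => x qx1 qx.
have mB : measurable (ball (x : M) r : set (borel M)).
  exact: measurable_metric_ball.
have c0 : 0 < (r `^ alpha)^-1 * Phi1 1 by rewrite mulr_gt0 ?invr_gt0.
have : ((((r `^ alpha)^-1 * Phi1 1)%:E * mu (ball (x : M) r)) <= 1)%E.
  rewrite -qx1 -integral_cst// integral_mkcond; apply: ae_le_lower_integral.
  - by move=> y _; rewrite erestrict_ge0// => z _; rewrite lee_fin ltW.
  - by move=> y _; rewrite lee_fin q_ge0.
  apply: filterS qx => y qxy _; rewrite /patch.
  by case: ifPn => [/set_mem|_]; rewrite lee_fin ?q_ge0.
by rewrite -lee_pdivlMl// mule1 invfM invrK.
Qed.

Hypothesis mu_neq0 : mu [set: M] <> 0%E.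

Lemma mu_exists (P : M -> Prop) :
  {ae mu, forall x : borel M, P x} -> exists x, P x.
Proof.
move=> [N [mN N0 NP]]; apply: contrapT => nP; apply: mu_neq0.
rewrite -N0; congr (mu _); apply/seteqP; split => // x _.
by apply: NP => /= Px; apply: nP; exists x.
Qed.

(** The exceptional null set of the volume bound depends on the radius; a common centre for all
    positive integer radii gives an exhaustion by balls of finite measure. *)
Lemma mu_sigma_finite : sigma_finite [set: borel M] mu.
Proof.
have [x xP] : exists x : M, forall n : nat,
    (mu (ball (x : M) n.+1%:R) <= (n.+1%:R `^ alpha / Phi1 1)%:E)%E.
  by apply: mu_exists; apply: ae_foralln => n; exact: ball_measure_le.
exists (fun n => ball (x : M) n.+1%:R).
  apply/esym; rewrite -subTset -(bigcup_metric_ball x) => y [n _ xy].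
  by exists n => //; apply: le_ball xy; rewrite ler_nat.
move=> n; split; first exact: measurable_metric_ball.
exact: le_lt_trans (xP n) (ltry _).
Qed.

(** If the total mass were a finite m, unit mass and q_r <= r^-alpha [Phi2 0] would give r^alpha <=
    [Phi2 0] m for every r > 0. *)
Lemma mu_infinite : mu [set: M] = +oo%E.
Proof.
apply/eqP; rewrite -leye_eq leNgt; apply/negP => muoo.
pose m := fine (mu [set: M]).
have muE : mu [set: M] = m%:E by rewrite fineK// ge0_fin_numE.
have m0 : 0 <= m by rewrite fine_ge0.
have bound r : 0 < r -> r `^ alpha <= Phi2 0 * m.
  move=> r0; have ra0 : 0 < r `^ alpha by rewrite powR_gt0.
  have [x [qx1 qx]] := mu_exists (filterI (q_int1 r0) (q_bounds r0)).
  rewrite -[leLHS]mulr1 -ler_pdivlMl// -lee_fin -qx1 mulrA EFinM -muE.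
  rewrite -integral_cst//; apply: ae_le_lower_integral.
  - by move=> y _; rewrite lee_fin q_ge0.
  - by move=> y _; rewrite lee_fin mulr_ge0 ?invr_ge0 ?powR_ge0 ?Phi2_ge0.
  apply: filterS qx => y [_ qxy] _; rewrite lee_fin; apply: (le_trans qxy).
  by rewrite ler_pM2l ?invr_gt0// Phi2_mono// divr_ge0 ?mdist_ge0// ltW.
pose b := Phi2 0 * m + 1.
have b0 : 0 < b by rewrite ltr_pwDr// mulr_ge0 ?Phi2_ge0.
have := bound (b `^ alpha^-1); rewrite powR_gt0// => /(_ isT).
by rewrite -powRrM mulVf ?gt_eqF// (powRr1 (ltW b0)) gerDl ler10.
Qed.

(** The value of [Phi2] at the left end of the dyadic shell [2^(k-1), 2^k), shell 0 being [0, 1); by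
    monotonicity it bounds [Phi2] on that shell. *)
Definition dyadic_bound (k : nat) : R :=
  if k is k'.+1 then Phi2 (2 ^+ k') else Phi2 0.

Local Notation a := dyadic_bound.

Lemma dyadic_bound_ge0 k : 0 <= a k.
Proof. by case: k => [|k] /=; rewrite Phi2_ge0// exprn_ge0. Qed.

(** The index of the shell of d(x,y)/r, that is, the least k with d(x,y) < 2^k r. The last clause
    places points outside a ball in the tail of the series. *)
Lemma dyadic_scale (r : R) (x y : M) : 0 < r -> exists k,
  [/\ ball x (2 ^+ k * r) y, Phi2 (mdist x y / r) <= a k &
      forall K, ~ ball x (2 ^+ K * r) y -> (K < k)%N].
Proof.
move=> r0; have ex : exists k, mdist x y < 2 ^+ k * r.
  have d0 : 0 <= mdist x y / r by rewrite divr_ge0 ?mdist_ge0// ltW.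
  exists (Num.bound (mdist x y / r)); rewrite -ltr_pdivrMr//.
  apply: lt_le_trans (archi_boundP d0) _.
  by rewrite -natrX ler_nat ltnW// ltn_expl.
exists (ex_minn ex); case: ex_minnP => k xyk kmin; split.
- by rewrite ballEmdist.
- case: k xyk kmin => [|k] _ kmin /=.
    by rewrite Phi2_mono// divr_ge0 ?mdist_ge0// ltW.
  rewrite Phi2_mono ?exprn_ge0// ler_pdivlMr// leNgt; apply/negP => /kmin.
  by rewrite ltnn.
- move=> K; rewrite ballEmdist /= => /negP; rewrite -leNgt => Kxy.
  rewrite ltnNge; apply/negP => kK; move: xyk; apply/negP; rewrite -leNgt.
  by apply: le_trans Kxy; rewrite ler_pM2r// ler_eXn2l// ltr1n.
Qed.

Hypothesis dyadic_sum :
  (\sum_(k <oo) (a k * (2 ^+ k) `^ (alpha + beta))%:E < +oo)%E.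

Let c k := a k * (2 ^+ k) `^ (alpha + beta).

Let c_ge0 k : (0 <= (c k)%:E)%E.
Proof. by rewrite lee_fin mulr_ge0 ?dyadic_bound_ge0 ?powR_ge0. Qed.

(** The tail is written as a full series with zeros below [K], so that it can be compared termwise
    and added to other series. *)
Lemma dyadic_tail e : 0 < e ->
  exists K, (\sum_(k <oo) (if (K <= k)%N then (c k)%:E else 0) <= e%:E)%E.
Proof.
move=> e0; have := nneseries_tail_cvg dyadic_sum (fun k _ => c_ge0 k).
have e0' : (0 < e%:E)%E by rewrite lte_fin.
move=> /(_ _ (open_ereal_lt' e0'))[K _ HK].
have ge0 k : (0 <= if (K <= k)%N then (c k)%:E else 0)%E by case: ifP.
exists K; rewrite (@nneseries_split _ _ 0%N K) ?add0n//.
rewrite big_nat big1 ?add0e => [|k /andP[_ kK]]; last by rewrite leqNgt kK.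
apply: le_trans (ltW (HK K (leqnn K))) => /=.
apply: lee_nneseries => [k _ _|k _]; first exact: ge0.
by case: ifP => // _; exact: c_ge0.
Qed.

(** At the smaller scale s = r / 2^K at most half of the unit mass of q_s lies outside the ball of
    radius r; the rest is at most s^-alpha [Phi2 0] times the measure of the ball. *)
Lemma ball_measure_ge : exists2 c0 : R, 0 < c0 & forall r : R, 0 < r ->
  {ae mu, forall x : borel M, (c0 * r `^ alpha)%:E <= mu (ball (x : M) r)}%E.
Proof.
(* The upper volume bound contributes a factor 1 / [Phi1 1] to the tail; this tolerance turns the
   product into 1/2. *)
have [K HK] := dyadic_tail (divr_gt0 Phi1_1 (ltr0n _ 2)).
(* The summand 1 keeps [b] positive even where only [Phi2 0] >= 0 is known. *)
pose b := 2 * (Phi2 0 + 1).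
have b0 : 0 < b by rewrite mulr_gt0// ltr_wpDl// Phi2_ge0.
have eK0 : (0 : R) < 2 ^+ K by rewrite exprn_gt0.
exists ((b * (2 ^+ K) `^ alpha)^-1) => [|r r0].
  by rewrite invr_gt0 mulr_gt0// powR_gt0.
pose s := r / 2 ^+ K; have s0 : 0 < s by rewrite divr_gt0.
have rE : r = 2 ^+ K * s by rewrite mulrC divfK ?gt_eqF.
have sa0 : 0 < s `^ alpha by rewrite powR_gt0.
have ek0 k : (0 : R) < 2 ^+ k * s by rewrite mulr_gt0 ?exprn_gt0.
have := ae_foralln (fun k => ball_measure_le (ek0 k)).
apply: filterS3 (q_int1 s0) (q_bounds s0) => x qx1 qx mux.
have mB k : measurable (ball (x : M) (2 ^+ k * s) : set (borel M)).
  exact: measurable_metric_ball.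
(* [F'] majorises q_s inside the ball of radius r, and outside it the term [F k] of the shell of y
   does; that shell has index above [K], so erasing the terms below [K] is harmless. *)
pose a' k : R := if (K <= k)%N then a k else 0.
have a'0 k : 0 <= a' k by rewrite /a'; case: ifP; rewrite ?dyadic_bound_ge0.
pose F k (y : borel M) : \bar R :=
  ((s `^ alpha)^-1 * a' k * \1_(ball (x : M) (2 ^+ k * s)) y)%:E.
have F0 k y : (0 <= F k y)%E.
  by rewrite lee_fin !mulr_ge0 ?invr_ge0// ltW.
have mF k : measurable_fun setT (F k).
  by apply/measurable_EFinP/measurable_funM => //; exact: measurable_indic.
pose F' (y : borel M) : \bar R :=
  ((s `^ alpha)^-1 * Phi2 0 * \1_(ball (x : M) r) y)%:E.
have intF k : (\int[mu]_y F k y = ((s `^ alpha)^-1 * a' k)%:E *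
    mu (ball (x : M) (2 ^+ k * s)))%E.
  rewrite /F; under eq_integral do rewrite EFinM.
  rewrite ge0_integralZl_EFin//.
  - by rewrite integral_indic// setIT.
  - exact/measurable_EFinP/measurable_indic.
  - by rewrite mulr_ge0 ?invr_ge0// ltW.
have mBr : measurable (ball (x : M) r : set (borel M)).
  exact: measurable_metric_ball.
have mF' : measurable_fun setT F'.
  by apply/measurable_EFinP/measurable_funM => //; exact: measurable_indic.
have F'0 y : (0 <= F' y)%E.
  by rewrite lee_fin !mulr_ge0 ?invr_ge0 ?Phi2_ge0// ltW.
have : (1 <= ((s `^ alpha)^-1 * Phi2 0)%:E * mu (ball (x : M) r) + 2^-1%:E)%E.
  rewrite -qx1.
  apply: (@le_trans _ _ (\int[mu]_y (F' y + \sum_(k <oo) F k y)))%E.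
    apply: ae_le_lower_integral.
    - by move=> y _; rewrite lee_fin q_ge0.
    - by move=> y _; rewrite adde_ge0// nneseries_ge0.
    apply: filterS qx => y [_ qxy] _.
    have [xy|xy] := pselect (ball (x : M) r y).
      apply: (@le_trans _ _ (F' y)); last by rewrite leeDl// nneseries_ge0.
      rewrite lee_fin indicE mem_set// mulr1; apply: (le_trans qxy).
      by rewrite ler_pM2l ?invr_gt0// Phi2_mono// divr_ge0 ?mdist_ge0// ltW.
    have [k [xyk Phik kK]] := dyadic_scale x y s0.
    have {}kK : (K < k)%N by apply: kK; rewrite -rE.
    apply: (@le_trans _ _ (F k y)); last first.
      apply: le_trans (leeDr _ (F'0 y)).
      apply: le_trans (nneseries_lim_ge k.+1 _); last by [].
      by rewrite big_nat_recr//= leeDr// sume_ge0.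
    rewrite lee_fin indicE mem_set// mulr1 /a' ltnW//; apply: (le_trans qxy).
    by rewrite ler_pM2l ?invr_gt0.
  rewrite ge0_integralD//; last 2 first.
  - by move=> y _; rewrite nneseries_ge0.
  - exact: ge0_emeasurable_sum.
  rewrite integral_nneseries//; apply: leeD.
    rewrite /F'; under eq_integral do rewrite EFinM.
    rewrite ge0_integralZl_EFin//.
    - by rewrite integral_indic// setIT.
    - exact/measurable_EFinP/measurable_indic.
    - by rewrite mulr_ge0 ?invr_ge0 ?Phi2_ge0// ltW.
  apply: (@le_trans _ _ ((Phi1 1)^-1%:E *
      \sum_(k <oo) (if (K <= k)%N then (c k)%:E else 0)))%E; last first.
    rewrite -lee_pdivlMl ?invr_gt0// invrK -EFinM.
    by apply: le_trans HK _.
  have cc0 k : (0 <= if (K <= k)%N then (c k)%:E else 0)%E by case: ifP.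
  rewrite -nneseriesZl//; apply: lee_nneseries => [k _ _|k _].
    exact: integral_ge0.
  rewrite intF /a'; case: ifP => Kk; last by rewrite mulr0 mul0e mule0.
  apply: (@le_trans _ _ (((s `^ alpha)^-1 * a k)%:E *
      ((2 ^+ k * s) `^ alpha / Phi1 1)%:E)%E).
    apply: lee_wpmul2l (mux k).
    by rewrite lee_fin mulr_ge0 ?dyadic_bound_ge0 ?invr_ge0// ltW.
  rewrite -EFinM lee_fin powRM ?(ltW s0)// ?exprn_ge0//.
  have -> : (s `^ alpha)^-1 * a k * ((2 ^+ k) `^ alpha * s `^ alpha / Phi1 1) =
      (Phi1 1)^-1 * (a k * (2 ^+ k) `^ alpha) by field; rewrite !gt_eqF.
  rewrite ler_pM2l ?invr_gt0// ler_wpM2l ?dyadic_bound_ge0// ler_powR//.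
    by rewrite exprn_ege1// ler1n.
  by rewrite lerDl ltW.
have m0 : (0 <= mu (ball (x : M) r))%E by [].
case: (mu _) m0 => [m| |]//; last by move=> _ _; rewrite leey.
rewrite !lee_fin => m0 mge.
have {}mge : 1 <= (s `^ alpha)^-1 * Phi2 0 * m + 2^-1 := mge.
have -> : r `^ alpha = (2 ^+ K) `^ alpha * s `^ alpha.
  by rewrite [in LHS]rE powRM ?(ltW s0)// ?exprn_ge0.
rewrite mulrA invfM mulfVK ?gt_eqF ?powR_gt0// ler_pdivrMl//.
rewrite -lerBlDr -mulrA ler_pdivlMl// in mge.
by rewrite /b; lra.
Qed.

End kernel_bounds.

(** * The moment integral against a dyadic series *)

Section dyadic_integral_test.
Context {R : realType}.
Variables (g : R) (Phi : R -> R).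
Hypothesis g_ge0 : 0 <= g.
Hypothesis Phi_ge0 : forall s : R, 0 <= s -> 0 <= Phi s.
Hypothesis Phi_mono : forall s t : R, 0 <= s -> s <= t -> Phi t <= Phi s.
Hypothesis Phi_int : (\int[@lebesgue_measure R]_(s in `]0%R, +oo[)
  (s `^ g * Phi s / s)%:E < +oo)%E.

Let F s := s `^ g * Phi s / s.
(** The interval [A k] ends at 2^(k-1), the point where [dyadic_bound Phi k] evaluates [Phi] for k
    >= 1. The height [h k] takes each factor of [F] at the end of [A k] where it is smallest, the
    power being increasing because g >= 0. *)
Let lo k : R := 2 ^+ k / 4.
Let hi k : R := 2 ^+ k / 2.
Let A k : set R := `]lo k, hi k].
Let h k : R := lo k `^ g * Phi (hi k) / hi k.

Let lo_gt0 k : 0 < lo k. Proof. by rewrite divr_gt0 ?exprn_gt0. Qed.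
Let hi_gt0 k : 0 < hi k. Proof. by rewrite divr_gt0 ?exprn_gt0. Qed.
Let lohi k : lo k <= hi k.
Proof. by rewrite ler_pM2l ?exprn_gt0// lef_pV2 ?posrE// ler_nat. Qed.
Let loS k : lo k.+1 = hi k.
Proof. by rewrite /lo /hi exprS; field. Qed.

Let h_ge0 k : 0 <= h k.
Proof. by rewrite /h !mulr_ge0 ?powR_ge0 ?invr_ge0 ?Phi_ge0// ltW. Qed.

(** The first conjunct carries the disjointness of the consecutive intervals through the induction:
    when s reaches [A n], all earlier steps have vanished. *)
Let step_sum n s : (lo n < s -> \sum_(k < n) h k * \1_(A k) s = 0) /\
  (0 < s -> \sum_(k < n) h k * \1_(A k) s <= F s).
Proof.
elim: n => [|n [ih0 ih]]; first by rewrite big_ord0; split => // s0;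
  rewrite /F !mulr_ge0 ?powR_ge0 ?invr_ge0 ?Phi_ge0// ltW.
rewrite big_ord_recr /= loS; split => [ns|s0].
  rewrite ih0 ?(le_lt_trans _ ns)// add0r indicE memNset ?mulr0//.
  by rewrite /A /= in_itv /= => /andP[_]; rewrite leNgt ns.
rewrite indicE; have [|] := boolP (s \in A n) => [|_].
  rewrite inE /A /= in_itv /= => /andP[ls sh].
  rewrite ih0// add0r mulr1 /h /F ler_pM ?mulr_ge0 ?powR_ge0 ?invr_ge0
    ?Phi_ge0 ?(ltW (hi_gt0 _))//.
    rewrite ler_pM ?powR_ge0 ?Phi_ge0 ?(ltW (hi_gt0 _))//.
      by apply: ge0_ler_powR => //; rewrite ?nnegrE ltW.
    by rewrite Phi_mono// ltW.
  by rewrite lef_pV2 ?posrE.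
by rewrite mulr0 addr0 ih.
Qed.

Let step_int n : (\sum_(k < n) (h k * lo k)%:E <=
  \int[@lebesgue_measure R]_(s in `]0%R, +oo[) (F s)%:E)%E.
Proof.
set D : set R := `]0%R, +oo[%classic.
have mD : measurable D := measurable_itv _.
apply: (@le_trans _ _ (\int[@lebesgue_measure R]_(s in D)
    \sum_(k < n) (h k * \1_(A k) s)%:E)%E).
  rewrite ge0_integral_sum//; last 2 first.
  - move=> k; apply/measurable_EFinP/measurable_funM => //.
    by apply: measurable_indic; exact: measurable_itv.
  - by move=> k s _; rewrite lee_fin mulr_ge0.
  apply: lee_sum => k _; under eq_integral do rewrite EFinM.
  rewrite ge0_integralZl_EFin//; last first.
    by apply/measurable_EFinP/measurable_indic; exact: measurable_itv.
  rewrite integral_indic//; last exact: measurable_itv.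
  rewrite setIidl; last first.
    move=> s; rewrite /A /D /= !in_itv /= andbT => /andP[+ _].
    exact: lt_trans.
  rewrite /= lebesgue_measure_itv /= lte_fin.
  have lohi' : lo k < hi k.
    by rewrite ltr_pM2l ?exprn_gt0// ltf_pV2 ?posrE// ltr_nat.
  by rewrite lohi' EFinM -EFinB lee_wpmul2l ?lee_fin// /lo /hi; lra.
apply: ae_le_lower_integral.
- by move=> s _; rewrite sume_ge0// => k _; rewrite lee_fin mulr_ge0.
- move=> s; rewrite /D /= in_itv /= andbT => s0.
  by rewrite lee_fin /F !mulr_ge0 ?powR_ge0 ?invr_ge0 ?Phi_ge0// ltW.
- apply: aeW => s; rewrite /D /= in_itv /= andbT => s0.
  by rewrite sumEFin lee_fin; have [_ ->] := step_sum n s.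
Qed.

Lemma dyadic_integral_test :
  (\sum_(k <oo) (dyadic_bound Phi k * (2 ^+ k) `^ g)%:E < +oo)%E.
Proof.
pose I := (\int[@lebesgue_measure R]_(s in `]0%R, +oo[) (F s)%:E)%E.
have I0 : (0 <= I)%E.
  apply: integral_ge0 => s; rewrite /= in_itv /= andbT => s0.
  by rewrite lee_fin !mulr_ge0 ?powR_ge0 ?invr_ge0 ?Phi_ge0// ltW.
have IE : I = (fine I)%:E by rewrite fineK// ge0_fin_numE.
(* The factor 4^g restores 2^k from [lo k] inside the power, and 2 compensates for [lo k / hi k] =
   1/2. The term k = 0 lies outside this comparison and contributes [Phi 0]. *)
pose C : R := 2 * 4 `^ g.
have C0 : 0 <= C by rewrite mulr_ge0 ?powR_ge0.
have cE k : dyadic_bound Phi k.+1 * (2 ^+ k.+1) `^ g = C * (h k.+1 * lo k.+1).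
  rewrite /= /h /C.
  have -> : hi k.+1 = 2 ^+ k by rewrite /hi exprS; field.
  have -> : (2 : R) ^+ k.+1 = 4 * lo k.+1 by rewrite /lo; field.
  rewrite powRM ?(ltW (lo_gt0 _))//.
  rewrite loS /hi; field; by rewrite expf_neq0.
apply: (@le_lt_trans _ _ (Phi 0 + C * fine I)%:E); last exact: ltry.
apply: lime_le.
  apply: is_cvg_nneseries => k _ _.
  by rewrite lee_fin mulr_ge0 ?dyadic_bound_ge0 ?powR_ge0.
apply: nearW => n; rewrite sumEFin lee_fin big_mkord.
have : \sum_(k < n) dyadic_bound Phi k * (2 ^+ k) `^ g <=
    Phi 0 + C * \sum_(k < n) (h k * lo k).
  elim: n => [|[|n] ih]; first by rewrite !big_ord0 mulr0 addr0 Phi_ge0.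
    rewrite !big_ord1 /= expr0 powR1 mulr1 lerDl.
    by rewrite !mulr_ge0 ?invr_ge0 ?powR_ge0 ?Phi_ge0 ?ltW.
  rewrite big_ord_recr [in leRHS]big_ord_recr /= mulrDr addrA lerD//.
  by rewrite -cE.
move=> /le_trans; apply; rewrite lerD2l ler_wpM2l//.
by rewrite -lee_fin -IE -sumEFin; exact: step_int.
Qed.

End dyadic_integral_test.

(** * Besov functions under heat kernel bounds *)

Section heat_semigroup.
Context {R : realType} {M : pmetricType R}.
Variable mu : {sigma_finite_measure set (borel M) -> \bar R}.
Variables (alpha beta : R) (Phi1 Phi2 : R -> R) (p : R -> M -> M -> R).
Hypothesis alpha_gt0 : 0 < alpha.
Hypothesis beta_gt0 : 0 < beta.
Hypothesis Phi1_1 : 0 < Phi1 1.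
Hypothesis Phi2_ge0 : forall s : R, 0 <= s -> 0 <= Phi2 s.
Hypothesis Phi1_mono : forall s t : R, 0 <= s -> s <= t -> Phi1 t <= Phi1 s.
Hypothesis Phi2_mono : forall s t : R, 0 <= s -> s <= t -> Phi2 t <= Phi2 s.
Hypothesis p_markov : forall t : R, 0 < t ->
  @symmetric_markov _ (borel M) _ mu (p t).
Hypothesis p_semigroup : forall s t : R, 0 < s -> 0 < t ->
  {ae mu, forall x : borel M, {ae mu, forall y : borel M,
    ((p (t + s) x y)%:E = \int[mu]_z (p s x z * p t z y)%:E)%E}}.

Hypothesis mu_neq0 : mu [set: M] <> 0%E.

Local Notation q r := (p (r `^ beta)).

Hypothesis q_bounds : forall r : R, 0 < r ->
  {ae mu, forall x : borel M, {ae mu, forall y : borel M,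
    (r `^ alpha)^-1 * Phi1 (mdist (x : M) y / r) <= q r x y /\
    q r x y <= (r `^ alpha)^-1 * Phi2 (mdist (x : M) y / r)}}.
Hypothesis dyadic_sum : (\sum_(k <oo)
  (dyadic_bound Phi2 k * (2 ^+ k) `^ (alpha + beta))%:E < +oo)%E.

Let q_markov r : 0 < r -> @symmetric_markov _ (borel M) _ mu (q r).
Proof. by move=> r0; apply: p_markov; rewrite powR_gt0. Qed.

Let q_ge0 (r : R) x y : 0 < r -> 0 <= q r x y.
Proof. by move=> r0; exact: markov_ge0 (q_markov r0) x y. Qed.

Let q_int1 t : 0 < t ->
  {ae mu, forall x : borel M, \int[mu]_y (q t x y)%:E = 1}%E.
Proof. by move=> t0; exact: markov_int1 (q_markov t0). Qed.

(** * Triviality of the Besov space above the critical exponent *)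

Section vanishing_energy.

Variable u : borel M -> R.
Hypothesis uL : u \in Lfun mu 2%:E.

Local Notation N2 := (dot mu u u).

Let mu_u : measurable_fun setT u := Lfun2_measurable uL.

(* [near r] replaces the relation [mdist x y < r], which need not be measurable
   for the product sigma-algebra. *)
Let near r : set (borel M * borel M) :=
  [set z | (r `^ alpha)^-1 * Phi1 1 <= q r z.1 z.2].

Let measurable_near r : 0 < r -> measurable (near r).
Proof.
move=> r0; have := markov_measurable (q_markov r0) measurableT
  (measurable_itv `[(r `^ alpha)^-1 * Phi1 1, +oo[).
rewrite setTI; congr measurable; apply/seteqP.
by split => z /=; rewrite in_itv /= andbT.
Qed.

Let sqd x y : R := (u x - u y) ^+ 2.

Let measurable_sqd :
  measurable_fun setT (fun z : borel M * borel M => sqd z.1 z.2).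
Proof.
by apply: measurable_funX; apply: measurable_funB; exact: measurableT_comp.
Qed.

Let sqd_ge0 x y : 0 <= sqd x y. Proof. exact: sqr_ge0. Qed.

(** A measurable substitute for the integral of |u(x) - u(y)|^2 over d(x,y) < r: for almost all
    pairs, d(x,y) < r implies [near r], which in turn implies d(x,y) < 2^K r as soon as
    [Phi2 (2 ^+ K) < Phi1 1]. *)
Let J r : \bar R := (\int[mu]_x \int[mu]_y (sqd x y * \1_(near r) (x, y))%:E)%E.

Let measurable_J r : 0 < r -> measurable_fun setT
  (fun z : borel M * borel M => (sqd z.1 z.2 * \1_(near r) z)%:E).
Proof.
move=> r0; apply/measurable_EFinP/measurable_funM => //.
by apply: measurable_indic; exact: measurable_near.
Qed.

Let Jint_ge0 r x y : (0 <= (sqd x y * \1_(near r) (x, y))%:E)%E.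
Proof. by rewrite lee_fin mulr_ge0. Qed.

Let measurable_q r : 0 < r -> measurable_fun setT
  (fun z : borel M * borel M => (q r z.1 z.2 * sqd z.1 z.2)%:E).
Proof.
move=> r0; apply/measurable_EFinP/measurable_funM => //.
exact: markov_measurable (q_markov r0).
Qed.

Let int_energy r : 0 < r ->
  (\int[mu]_x \int[mu]_y (q r x y * sqd x y)%:E =
   (2 * energy mu p (r `^ beta) u)%:E)%E.
Proof. by move=> r0; rewrite (kernel_energyE (q_markov r0) uL). Qed.

(** On [near r] one has 1 <= C q_r, so J is at most C times the kernel energy, itself at most 2
    |u|^2. This serves the scales that the Besov condition does not reach. *)
Let J_le_mass r : 0 < r -> (J r <= (r `^ alpha / Phi1 1 * (2 * N2))%:E)%E.
Proof.
move=> r0; have ra0 : 0 < r `^ alpha by rewrite powR_gt0.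
pose C : R := r `^ alpha / Phi1 1; have C0 : 0 < C by rewrite divr_gt0.
have mq := measurable_q r0.
have q0 z : (0 <= (q r z.1 z.2 * sqd z.1 z.2)%:E)%E.
  by rewrite lee_fin mulr_ge0 ?q_ge0.
apply: (@le_trans _ _ (C%:E *
    \int[mu]_x \int[mu]_y (q r x y * sqd x y)%:E)%E); last first.
  rewrite int_energy// -EFinM lee_fin ler_pM2l// ler_pM2l//.
  by apply: (energy_le p_markov p_semigroup) => //; rewrite powR_gt0.
have mF : measurable_fun setT
    (fun x : borel M => \int[mu]_y (q r x y * sqd x y)%:E)%E.
  exact: (measurable_fun_fubini_tonelli_F _ mq q0).
rewrite -ge0_integralZl_EFin//; last 2 first.
- by move=> x _; apply: integral_ge0 => y _; exact: (q0 (x, y)).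
- exact: ltW.
apply: ae_le_lower_integral => [x _|x _|].
- exact: integral_ge0.
- rewrite mule_ge0 ?lee_fin ?(ltW C0)// integral_ge0// => y _.
  exact: (q0 (x, y)).
apply: aeW => x _; rewrite -ge0_integralZl_EFin//; last 3 first.
- by move=> y _; exact: (q0 (x, y)).
- exact: measurableT_comp mq (pair1_measurable x).
- exact: ltW.
apply: ae_le_lower_integral => [//|y _|].
  by rewrite mule_ge0 ?lee_fin ?(ltW C0)// mulr_ge0 ?q_ge0.
apply: aeW => y _; rewrite -EFinM lee_fin.
have -> : C * (q r x y * sqd x y) = sqd x y * (C * q r x y) by ring.
rewrite ler_wpM2l// indicE; have [|] := boolP ((x, y) \in near r) => [|_].
  rewrite inE /near /= => xy; rewrite -ler_pdivrMl// mulr1.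
  by rewrite /C invfM invrK.
by rewrite mulr_ge0 ?q_ge0 ?(ltW C0).
Qed.

(** Beyond distance 2^K r the upper kernel bound then falls below the threshold defining [near r].
    All weights are at least 1, so the term of index K + 1 in a small tail dominates
    [Phi2 (2 ^+ K)]. *)
Lemma Phi2_lt_Phi1 : exists K, Phi2 (2 ^+ K) < Phi1 1.
Proof.
have [K HK] := dyadic_tail Phi2_ge0 dyadic_sum (divr_gt0 Phi1_1 (ltr0n _ 2)).
exists K; apply: (@le_lt_trans _ _ (Phi1 1 / 2)).
  2: by rewrite ltr_pdivrMr// ltr_pMr// ltr1n.
have c0 k : 0 <= dyadic_bound Phi2 k * (2 ^+ k) `^ (alpha + beta).
  by rewrite mulr_ge0 ?dyadic_bound_ge0 ?powR_ge0.
apply: (@le_trans _ _ (dyadic_bound Phi2 K.+1 * (2 ^+ K.+1) `^ (alpha + beta))).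
  rewrite -[leLHS]mulr1 ler_wpM2l ?Phi2_ge0 ?exprn_ge0//.
  have e1 : (1 : R) <= 2 ^+ K.+1 by rewrite exprn_ege1// ler1n.
  have ab0 := addr_ge0 (ltW alpha_gt0) (ltW beta_gt0).
  by have := ler_powR e1 ab0; rewrite powRr0.
pose c k : \bar R := if (K <= k)%N then
  (dyadic_bound Phi2 k * (2 ^+ k) `^ (alpha + beta))%:E else 0%E.
have c0' k : (0 <= c k)%E by rewrite /c; case: ifP => // _; rewrite lee_fin.
rewrite -lee_fin; apply: le_trans HK; apply: (@le_trans _ _ (c K.+1)).
  by rewrite /c leqnSn.
apply: le_trans (nneseries_lim_ge K.+2 _); last by move=> k _ _; exact: c0'.
by rewrite big_nat_recr// leeDr//; apply: sume_ge0 => k _; exact: c0'.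
Qed.

Variable sigma : R.
Hypothesis sigma_gt : beta / 2 < sigma.
Hypothesis uW : (besov_energy mu sigma u < +oo)%E.

Local Notation W := (fine (besov_energy mu sigma u)).

Let W_sup r : 0 < r -> r < 1 ->
  (\int[mu]_x ((mu (ball (x : M) r))^-1 *
    \int[mu]_(y in ball (x : M) r) (`|u y - u x| ^+ 2)%:E) <=
   (r `^ (2 * sigma) * W)%:E)%E.
Proof.
move=> r0 r1; set I := (X in (X <= _)%E).
have I0 : (0 <= I)%E.
  apply: integral_ge0 => x _; rewrite mule_ge0 ?inve_ge0//.
  by apply: integral_ge0 => y _; rewrite lee_fin exprn_ge0.
have W1 : ((r `^ (- (2 * sigma)))%:E * I <= besov_energy mu sigma u)%E.
  by apply: ereal_sup_ubound; exists r => //=; rewrite in_itv /= r0 r1.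
have WE : (W%:E = besov_energy mu sigma u).
  rewrite fineK// ge0_fin_numE//; apply: le_trans W1.
  by rewrite mule_ge0// lee_fin powR_ge0.
move: W1; rewrite -WE powRN -lee_pdivlMl ?invr_gt0 ?powR_gt0//.
by rewrite invrK -EFinM.
Qed.

(** [near r] forces y into the ball of radius s = 2^K r, and the upper volume bound replaces the
    normalisation by the measure of that ball with a constant. *)
Let J_le_besov K r : Phi2 (2 ^+ K) < Phi1 1 -> 0 < r -> 2 ^+ K * r < 1 ->
  (J r <= ((2 ^+ K * r) `^ alpha / Phi1 1 *
           ((2 ^+ K * r) `^ (2 * sigma) * W))%:E)%E.
Proof.
move=> PhiK r0 Kr1; set s := 2 ^+ K * r.
have s0 : 0 < s by rewrite mulr_gt0 ?exprn_gt0.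
pose v : R := s `^ alpha / Phi1 1.
have v0 : 0 < v by rewrite divr_gt0// powR_gt0.
rewrite EFinM -lee_pdivrMl//; apply: le_trans (W_sup s0 Kr1).
have mF : measurable_fun setT
    (fun x : borel M => \int[mu]_y (sqd x y * \1_(near r) (x, y))%:E)%E.
  apply: (measurable_fun_fubini_tonelli_F _ (measurable_J r0)) => z.
  by rewrite lee_fin mulr_ge0.
rewrite /J -ge0_integralZl_EFin//; last 2 first.
- by move=> x _; apply: integral_ge0.
- by rewrite invr_ge0 ltW.
apply: ae_le_lower_integral.
- by move=> x _; rewrite mule_ge0 ?lee_fin ?invr_ge0 ?(ltW v0)// integral_ge0.
- move=> x _; rewrite mule_ge0 ?inve_ge0//; apply: integral_ge0 => y _.
  by rewrite lee_fin exprn_ge0.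
have vol := ball_measure_le Phi1_1 Phi1_mono q_ge0 q_int1 q_bounds s0.
apply: filterS2 vol (q_bounds r0) => x xvol xq _.
apply: lee_pmul => //.
- by rewrite lee_fin invr_ge0 ltW.
- exact: integral_ge0.
- rewrite -[leLHS]/((v^-1)%:E).
  rewrite -[X in (X <= _)%E](_ : v%:E^-1 = _)%E; last by rewrite inver gt_eqF.
  by rewrite lee_pV2 ?inE ?lee_fin ?(ltW v0).
rewrite [leRHS]integral_mkcond; apply: ae_le_lower_integral.
- by move=> y _; exact: Jint_ge0.
- by move=> y _; rewrite erestrict_ge0// => z _; rewrite lee_fin exprn_ge0.
apply: filterS xq => y [_ qxy] _.
rewrite indicE; have [|] := boolP ((x, y) \in near r) => [|_]; last first.
  by rewrite mulr0 erestrict_ge0// => z _; rewrite lee_fin exprn_ge0.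
rewrite inE /near /= => xy.
have xsy : ball (x : M) s y.
  rewrite ballEmdist /= ltNge; apply/negP => sxy; move: xy; apply/negP.
  rewrite -ltNge (le_lt_trans qxy)// ltr_pM2l ?invr_gt0 ?powR_gt0//.
  apply: le_lt_trans PhiK; rewrite Phi2_mono ?exprn_ge0//.
  by rewrite ler_pdivlMr.
rewrite patchE mem_set// mulr1 lee_fin /sqd real_normK ?num_real//.
by rewrite -sqrrN opprB.
Qed.

(** Almost every pair (x,y) belongs to [near (2 ^+ k * r)] for the index k of its own shell, where
    q_r <= r^-alpha [dyadic_bound Phi2 k]; this single term already dominates the integrand. *)
Let energy_series r : 0 < r -> ((2 * energy mu p (r `^ beta) u)%:E <=
  \sum_(k <oo) ((r `^ alpha)^-1 * dyadic_bound Phi2 k)%:E * J (2 ^+ k * r))%E.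
Proof.
move=> r0; have e0 k : 0 < 2 ^+ k * r by rewrite mulr_gt0 ?exprn_gt0.
have a0 := dyadic_bound_ge0 Phi2_ge0.
pose v k : R := (r `^ alpha)^-1 * dyadic_bound Phi2 k.
have v0 k : 0 <= v k by rewrite mulr_ge0 ?invr_ge0 ?powR_ge0.
have vJ0 k x y :
    (0 <= (v k)%:E * (sqd x y * \1_(near (2 ^+ k * r)) (x, y))%:E)%E.
  by apply: mule_ge0; [rewrite lee_fin|exact: Jint_ge0].
have mJ k := measurable_J (e0 k).
have J0 k z : (0 <= (sqd z.1 z.2 * \1_(near (2 ^+ k * r)) z)%:E)%E.
  by rewrite lee_fin mulr_ge0.
have mI k : measurable_fun setT (fun x : borel M =>
    (\int[mu]_y (sqd x y * \1_(near (2 ^+ k * r)) (x, y))%:E)%E).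
  exact: (measurable_fun_fubini_tonelli_F _ (mJ k) (J0 k)).
have -> : (\sum_(k <oo) (v k)%:E * J (2 ^+ k * r) = \int[mu]_x \sum_(k <oo)
    (v k)%:E * \int[mu]_y (sqd x y * \1_(near (2 ^+ k * r)) (x, y))%:E)%E.
  rewrite integral_nneseries//; last 2 first.
  - by move=> k; exact: measurable_funeM.
  - by move=> k x _; rewrite mule_ge0 ?lee_fin// integral_ge0.
  apply: eq_eseriesr => k _; rewrite ge0_integralZl_EFin// => x _.
  exact: integral_ge0.
rewrite -int_energy//; apply: ae_le_lower_integral.
- by move=> x _; apply: integral_ge0 => y _; rewrite lee_fin mulr_ge0 ?q_ge0.
- move=> x _; apply: nneseries_ge0 => k _ _.
  by rewrite mule_ge0 ?lee_fin// integral_ge0.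
have nearP : {ae mu, forall x : borel M, {ae mu, forall y : borel M,
    forall k, ball (x : M) (2 ^+ k * r) y -> near (2 ^+ k * r) (x, y)}}.
  have := ae_foralln (fun k =>
    q_lower_ball Phi1_mono q_bounds (e0 k) (lexx (2 ^+ k * r))).
  by apply: filterS => x xk; exact: ae_foralln.
apply: filterS2 nearP (q_bounds r0) => x xnear xq _.
have -> : (\sum_(k <oo)
    (v k)%:E * \int[mu]_y (sqd x y * \1_(near (2 ^+ k * r)) (x, y))%:E =
    \int[mu]_y \sum_(k <oo)
      (v k)%:E * (sqd x y * \1_(near (2 ^+ k * r)) (x, y))%:E)%E.
  have mJx k : measurable_fun setT
      (fun y : borel M => (sqd x y * \1_(near (2 ^+ k * r)) (x, y))%:E).
    exact: measurableT_comp (mJ k) (pair1_measurable x).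
  rewrite integral_nneseries//; last by move=> k; exact: measurable_funeM.
  by apply: eq_eseriesr => k _; rewrite ge0_integralZl_EFin.
apply: ae_le_lower_integral.
- by move=> y _; rewrite lee_fin mulr_ge0 ?q_ge0.
- by move=> y _; apply: nneseries_ge0 => k _ _; exact: vJ0.
apply: filterS2 xnear xq => y ynear [_ qxy] _.
have [k [/ynear xyk Phik _]] := dyadic_scale Phi2_mono (x : M) y r0.
apply: (@le_trans _ _
    ((v k)%:E * (sqd x y * \1_(near (2 ^+ k * r)) (x, y))%:E)%E).
  rewrite -EFinM lee_fin indicE mem_set// mulr1 ler_wpM2r//.
  by apply: (le_trans qxy); rewrite ler_pM2l ?invr_gt0 ?powR_gt0.
apply: le_trans (nneseries_lim_ge k.+1 _); last first.
  by move=> n _ _; exact: vJ0.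
rewrite big_nat_recr// leeDr//; apply: sume_ge0 => n _; exact: vJ0.
Qed.

Let W_ge0 : 0 <= W.
Proof.
apply: fine_ge0; apply: le_trans (ereal_sup_ubound _); last first.
  by exists (2^-1) => //=; rewrite in_itv /= invr_gt0 ltr0n invf_lt1 ?ltr1n.
rewrite mule_ge0 ?lee_fin ?powR_ge0//; apply: integral_ge0 => x _.
rewrite mule_ge0 ?inve_ge0//; apply: integral_ge0 => y _.
by rewrite lee_fin exprn_ge0.
Qed.

Local Notation delta := (2 * sigma - beta).

(** The bound valid at all scales makes the k-th term of [energy_series] proportional to r^beta
    times the k-th term of the convergent dyadic series; the extra power [delta] at small scales is
    what makes the energy o(r^beta). *)
Let J_scaled : exists K C, [/\ 0 <= C,
  forall r, 0 < r -> (J r <= (C * r `^ (alpha + beta))%:E)%E &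
  forall r, 0 < r -> 2 ^+ K * r < 1 ->
    (J r <= (C * r `^ (alpha + beta) * (2 ^+ K * r) `^ delta)%:E)%E].
Proof.
have [K PhiK] := Phi2_lt_Phi1.
have eK0 : (0 : R) < 2 ^+ K by rewrite exprn_gt0.
pose C1 : R := (2 ^+ K) `^ (alpha + beta) * W / Phi1 1.
(* For 2^K r >= 1 the mass bound lacks a factor r^beta, supplied by (2^K r)^beta >= 1. *)
pose C2 : R := (2 ^+ K) `^ beta * (2 * N2) / Phi1 1.
have C1_ge0 : 0 <= C1.
  by rewrite !mulr_ge0 ?powR_ge0 ?invr_ge0 ?W_ge0 ?(ltW Phi1_1).
have C2_ge0 : 0 <= C2.
  by rewrite !mulr_ge0 ?powR_ge0 ?invr_ge0 ?dot_ge0 ?(ltW Phi1_1).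
have small r : 0 < r -> 2 ^+ K * r < 1 ->
    (J r <= (C1 * r `^ (alpha + beta) * (2 ^+ K * r) `^ delta)%:E)%E.
  move=> r0 Kr1; apply: (le_trans (J_le_besov PhiK r0 Kr1)).
  have s0 : 0 < 2 ^+ K * r by rewrite mulr_gt0.
  rewrite lee_fin le_eqVlt; apply/orP; left; apply/eqP.
  have -> : (2 ^+ K * r) `^ (2 * sigma) =
      (2 ^+ K * r) `^ beta * (2 ^+ K * r) `^ delta.
    by rewrite -gt0_powRD//; congr (_ `^ _); ring.
  rewrite /C1.
  have -> : (2 ^+ K) `^ (alpha + beta) * W / Phi1 1 * r `^ (alpha + beta) =
      (2 ^+ K * r) `^ (alpha + beta) * W / Phi1 1.
    by rewrite powRM ?(ltW eK0) ?(ltW r0)//; ring.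
  by rewrite gt0_powRD//; ring.
exists K, (C1 + C2); split.
- exact: addr_ge0.
- move=> r r0; have [Kr1|Kr1] := ltP (2 ^+ K * r) 1.
    apply: (le_trans (small r r0 Kr1)); rewrite lee_fin.
    apply: (@le_trans _ _ (C1 * r `^ (alpha + beta))).
      rewrite ler_piMr ?(mulr_ge0 C1_ge0) ?powR_ge0//.
      have s01 : 0 < 2 ^+ K * r <= 1 by rewrite mulr_gt0// ltW.
      have d0 : 0 <= delta by rewrite subr_ge0 ltW// mulrC -ltr_pdivrMr.
      by have := ger_powR s01 d0; rewrite powRr0.
    by rewrite ler_wpM2r ?powR_ge0// lerDl.
  apply: (le_trans (J_le_mass r0)); rewrite lee_fin.
  apply: (@le_trans _ _ (C2 * r `^ (alpha + beta))); last first.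
    by rewrite ler_wpM2r ?powR_ge0// lerDr.
  rewrite gt0_powRD//.
  have -> : C2 * (r `^ alpha * r `^ beta) =
      r `^ alpha / Phi1 1 * (2 * N2) * (2 ^+ K * r) `^ beta.
    by rewrite powRM ?(ltW eK0) ?(ltW r0)// /C2; ring.
  rewrite ler_peMr ?mulr_ge0 ?powR_ge0 ?invr_ge0 ?dot_ge0 ?(ltW Phi1_1)//.
  by have := ler_powR Kr1 (ltW beta_gt0); rewrite powRr0.
- move=> r r0 Kr1; apply: (le_trans (small r r0 Kr1)); rewrite lee_fin.
  by rewrite !ler_wpM2r ?powR_ge0// lerDl.
Qed.

Let delta_gt0 : 0 < delta.
Proof. by rewrite subr_gt0 mulrC -ltr_pdivrMr. Qed.

(** The series is cut at a fixed index [N]: the tail is small uniformly in r, and the finitely many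
    earlier scales tend to 0 with r and so gain a small factor [eta]. *)
Let energy_small e : 0 < e -> exists2 r0, 0 < r0 & forall r, 0 < r -> r < r0 ->
  energy mu p (r `^ beta) u <= e * r `^ beta.
Proof.
move=> e0; have [K [C [C0 JC JCK]]] := J_scaled.
pose c k : R := dyadic_bound Phi2 k * (2 ^+ k) `^ (alpha + beta).
have c_ge0 k : 0 <= c k by rewrite mulr_ge0 ?dyadic_bound_ge0 ?powR_ge0.
have cE0 k : (0 <= (c k)%:E)%E by rewrite lee_fin.
pose S : R := fine (\sum_(k <oo) (c k)%:E).
have SE : (\sum_(k <oo) (c k)%:E)%E = S%:E.
  by rewrite fineK// ge0_fin_numE// nneseries_ge0.
have S0 : 0 <= S by apply: fine_ge0; exact: nneseries_ge0.
have C10 : 0 < C + 1 by rewrite ltr_wpDl.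
have S10 : 0 < S + 1 by rewrite ltr_wpDl.
pose e1 : R := e / (C + 1); have e10 : 0 < e1 by rewrite divr_gt0.
have [N HN] := dyadic_tail Phi2_ge0 dyadic_sum e10.
(* For 2^K 2^N r < m every scale of index below [N] is in the small regime, and [eta] is at most
   [e1 / (S + 1)]; hence [eta * S] and the tail are both at most [e1]. *)
pose m : R := Num.min 1 ((e1 / (S + 1)) `^ delta^-1).
have m0 : 0 < m by rewrite lt_min ltr01 powR_gt0 ?divr_gt0.
have KN0 : (0 : R) < 2 ^+ K * 2 ^+ N by rewrite mulr_gt0 ?exprn_gt0.
exists (m / (2 ^+ K * 2 ^+ N)) => [|r r0]; first by rewrite divr_gt0.
rewrite ltr_pdivlMr// => rm.
have rb0 : 0 < r `^ beta by rewrite powR_gt0.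
have ra0 : 0 < r `^ alpha by rewrite powR_gt0.
pose eta : R := (2 ^+ K * 2 ^+ N * r) `^ delta.
have r1 : 2 ^+ K * 2 ^+ N * r < 1.
  by rewrite mulrC; apply: (lt_le_trans rm); rewrite ge_min lexx.
have eta_le : eta <= e1 / (S + 1).
  have E1 : 0 <= e1 / (S + 1) by rewrite divr_ge0 ?ltW.
  have -> : e1 / (S + 1) = ((e1 / (S + 1)) `^ delta^-1) `^ delta.
    by rewrite -powRrM mulVf ?lt0r_neq0// powRr1.
  apply: ge0_ler_powR; rewrite ?nnegrE ?powR_ge0 ?(ltW delta_gt0)//.
    by rewrite mulr_ge0 ?(ltW KN0) ?(ltW r0).
  by rewrite mulrC; apply: (le_trans (ltW rm)); rewrite ge_min lexx orbT.
have eta0 : 0 <= eta by exact: powR_ge0.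
pose t k : \bar R := if (N <= k)%N then (c k)%:E else 0%E.
have t0 k : (0 <= t k)%E by rewrite /t; case: ifP.
have B0 : 0 <= C * r `^ beta by rewrite mulr_ge0// ltW.
have key : ((2 * energy mu p (r `^ beta) u)%:E <=
    (C * r `^ beta * (eta * S + e1))%:E)%E.
  apply: (le_trans (energy_series r0)).
  (* Termwise, indices below [N] are bounded by the part with [eta], the others by the tail part
     [t k]. *)
  apply: (@le_trans _ _ ((C * r `^ beta)%:E *
      (\sum_(k <oo) (eta%:E * (c k)%:E + t k)))%E); last first.
    rewrite nneseriesD//; last first.
      by move=> k _ _; rewrite mule_ge0// lee_fin.
    rewrite nneseriesZl// SE [leRHS]EFinM lee_wpmul2l ?lee_fin//.
    by rewrite EFinD EFinM leeD2l.
  rewrite -nneseriesZl; last first.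
    by move=> k _; rewrite adde_ge0// mule_ge0// lee_fin.
  have k0 k : 0 < 2 ^+ k * r by rewrite mulr_gt0 ?exprn_gt0.
  apply: lee_nneseries => [k _ _|k _].
    rewrite mule_ge0 ?lee_fin ?mulr_ge0 ?invr_ge0 ?powR_ge0 ?dyadic_bound_ge0//.
    by apply: integral_ge0 => x _; exact: integral_ge0.
  have v0 : (0 <= ((r `^ alpha)^-1 * dyadic_bound Phi2 k)%:E)%E.
    by rewrite lee_fin mulr_ge0 ?invr_ge0 ?powR_ge0 ?dyadic_bound_ge0.
  have scale : (r `^ alpha)^-1 * dyadic_bound Phi2 k *
      (C * (2 ^+ k * r) `^ (alpha + beta)) = C * r `^ beta * c k.
    rewrite powRM ?exprn_ge0 ?(ltW r0)// (gt0_powRD _ _ r0) /c; field.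
    exact: lt0r_neq0.
  rewrite /t; case: ifP => [Nk|/negbT]; last first.
    rewrite -ltnNge => kN.
    have kN2 : 2 ^+ K * (2 ^+ k * r) <= 2 ^+ K * 2 ^+ N * r.
      rewrite mulrA ler_pM2r// ler_pM2l ?exprn_gt0// ler_eXn2l ?ltr1n//.
      exact: ltnW.
    have kr1 := le_lt_trans kN2 r1.
    apply: le_trans (lee_wpmul2l v0 (JCK _ (k0 k) kr1)) _.
    rewrite adde0 -!EFinM lee_fin.
    rewrite [leLHS](_ : _ =
        C * r `^ beta * (c k * (2 ^+ K * (2 ^+ k * r)) `^ delta)); last first.
      by rewrite [RHS]mulrA -scale; ring.
    rewrite ler_wpM2l// mulrC ler_wpM2r//; apply: ge0_ler_powR => //.
    - exact: ltW.
    - by rewrite nnegrE mulr_ge0 ?exprn_ge0 ?(ltW (k0 k)).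
    - by rewrite nnegrE mulr_ge0 ?(ltW KN0) ?(ltW r0).
  apply: le_trans (lee_wpmul2l v0 (JC _ (k0 k))) _.
  rewrite [leRHS](_ : _ = (C * r `^ beta * (eta * c k + c k))%:E)// -EFinM.
  by rewrite lee_fin scale ler_wpM2l// lerDr mulr_ge0.
move: key; rewrite lee_fin => key.
have etaS : eta * S <= e1.
  apply: (@le_trans _ _ (e1 / (S + 1) * (S + 1))).
    by rewrite ler_pM// lerDl.
  by rewrite divfK// lt0r_neq0.
have Ce1 : C * e1 <= e.
  by rewrite /e1 mulrA ler_pdivrMr// mulrC ler_wpM2l ?lerDl// ltW.
have : C * r `^ beta * (eta * S + e1) <= C * r `^ beta * (e1 + e1).
  by rewrite ler_wpM2l// lerD2r.
have : r `^ beta * (C * e1) <= r `^ beta * e by rewrite ler_pM2l.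
nra.
Qed.

Lemma energy_eq0 t : 0 < t -> energy mu p t u <= 0.
Proof.
move=> t0; rewrite leNgt; apply/negP => Et.
(* With this [e] and s = 2^-n t small enough, E_t(u) <= 2^n E_s(u) <= e t = E_t(u) / 2, which
   contradicts positivity. *)
have [e e0 eE] : exists2 e : R, 0 < e & e * t = energy mu p t u / 2.
  exists (energy mu p t u / 2 / t); first by rewrite !divr_gt0.
  by rewrite divfK// gt_eqF.
have [r0 r00 Hr] := energy_small e0.
have [n tn] : exists n, t / r0 `^ beta < 2 ^+ n.
  exists (Num.bound (t / r0 `^ beta)).
  have tr0 : 0 <= t / r0 `^ beta by rewrite divr_ge0 ?powR_ge0// ltW.
  apply: (lt_le_trans (archi_boundP tr0)).
  by rewrite -natrX ler_nat ltnW// ltn_expl.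
have n0 : (0 : R) < 2 ^+ n by rewrite exprn_gt0.
have [s s0 ns] : exists2 s : R, 0 < s & 2 ^+ n * s = t.
  by exists (t / 2 ^+ n); rewrite ?divr_gt0// mulrC divfK// gt_eqF.
have [r r_gt0 rs] : exists2 r : R, 0 < r & r `^ beta = s.
  exists (s `^ beta^-1); first by rewrite powR_gt0.
  by rewrite -powRrM mulVf ?gt_eqF// powRr1// ltW.
have rr0 : r < r0.
  rewrite ltNge; apply/negP => r0r.
  have : r0 `^ beta <= s.
    by rewrite -rs; apply: ge0_ler_powR => //; rewrite ?nnegrE ltW.
  apply/negP; rewrite -ltNge -(ltr_pM2l n0) ns.
  by rewrite -ltr_pdivrMr ?powR_gt0.
have := energy_expn p_markov p_semigroup n s0 uL; rewrite ns.
have := Hr r r_gt0 rr0; rewrite rs -(ler_pM2l n0) mulrCA ns eE.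
move=> Es /le_trans/(_ Es).
by rewrite leNgt ltr_pdivrMr// ltr_pMr// ltr1n.
Qed.

Lemma besov_eq0 : u = cst 0 %[ae mu].
Proof.
have qsqd r : 0 < r -> {ae mu, forall x : borel M, {ae mu, forall y : borel M,
    q r x y * sqd x y = 0}}.
  move=> r0; have mq := measurable_q r0.
  have q0 z : (0 <= (q r z.1 z.2 * sqd z.1 z.2)%:E)%E.
    by rewrite lee_fin mulr_ge0 ?q_ge0.
  have mF : measurable_fun setT
      (fun x : borel M => \int[mu]_y (q r x y * sqd x y)%:E)%E.
    exact: (measurable_fun_fubini_tonelli_F _ mq q0).
  have F0 x : (0 <= \int[mu]_y (q r x y * sqd x y)%:E)%E.
    by apply: integral_ge0 => y _; exact: (q0 (x, y)).
  have /(ae_eq_integral_abs mu measurableT mF) :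
      (\int[mu]_x `|\int[mu]_y (q r x y * sqd x y)%:E| = 0)%E.
    under eq_integral do rewrite gee0_abs//.
    apply/eqP; rewrite eq_le integral_ge0// andbT int_energy// lee_fin.
    by rewrite pmulr_rle0// energy_eq0// powR_gt0.
  apply: filterS => x /(_ I) /= Fx0.
  have mqx : measurable_fun setT (fun y : borel M => (q r x y * sqd x y)%:E).
    exact: measurableT_comp mq (pair1_measurable x).
  have /(ae_eq_integral_abs mu measurableT mqx) :
      (\int[mu]_y `|(q r x y * sqd x y)%:E| = 0)%E.
    under eq_integral do rewrite gee0_abs ?(q0 (x, _))//.
    exact: Fx0.
  by apply: filterS => y /(_ I) /= [].
have n0 (n : nat) : (0 : R) < n.+1%:R by [].
(* A single point x good for all radii n + 1: the balls around it exhaust the space and q is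
   positive on them, so u equals u(x) almost everywhere. The shift keeps the radii positive. *)
have [x [xq xball]] := mu_exists mu_neq0 (filterI
  (ae_foralln (fun n => qsqd _ (n0 n)))
  (ae_foralln (fun n =>
    q_lower_ball Phi1_mono q_bounds (n0 n) (lexx n.+1%:R)))).
have ux : {ae mu, forall y : borel M, u y = u x}.
  apply: filterS2 (ae_foralln xq) (ae_foralln xball) => y yq yball.
  have [n _ xy] : (\bigcup_n ball (x : M) n%:R) y by rewrite bigcup_metric_ball.
  have qxy : 0 < q n.+1%:R x y.
    have xy' : ball (x : M) n.+1%:R y by apply: le_ball xy; rewrite ler_nat.
    by apply: lt_le_trans (yball n xy'); rewrite mulr_gt0 ?invr_gt0 ?powR_gt0.
  have /eqP := yq n; rewrite mulf_eq0 gt_eqF//= sqrf_eq0 subr_eq0.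
  by move=> /eqP.
have muoo := mu_infinite alpha_gt0 Phi2_ge0 Phi2_mono q_ge0 q_int1 q_bounds
  mu_neq0.
have [_] := (Lfun2P mu u).1 uL.
rewrite (ae_eq_integral (cst (u x ^+ 2)%:E))//; last 2 first.
- exact/measurable_EFinP/measurable_funX.
- by apply: filterS ux => y -> _.
rewrite integral_cst// [X in (_ * X)%E]muoo.
have [ux0 _|ux0] := eqVneq (u x) 0.
  by apply: filterS ux => y -> _.
by rewrite gt0_muley ?lte_fin ?exprn_even_gt0// ltxx.
Qed.

End vanishing_energy.

(** * Infinite dimension at the critical exponent *)

Lemma dyadic_time (r : R) : 0 < r -> r < 1 -> exists n s,
  [/\ s `^ beta = (2 ^+ n)^-1, r <= s & s `^ beta <= 2 * r `^ beta].
Proof.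
move=> r0 r1; have rb0 : 0 < r `^ beta by rewrite powR_gt0.
(* [energy_smoothing] concerns times 2^-n only, so r^beta is rounded up to such a time. The least
   such n gives 2^-(n+1) < r^beta <= 2^-n, the second inequality for n = 0 coming from r < 1. *)
have ex : exists n, 1 < 2 ^+ n.+1 * r `^ beta.
  exists (Num.bound (r `^ beta)^-1); rewrite -ltr_pdivrMr// mul1r.
  apply: lt_le_trans (archi_boundP _) _; first by rewrite invr_ge0 ltW.
  by rewrite -natrX ler_nat ltnW// (ltn_trans _ (ltn_expl _ _)).
case: (ex_minnP ex) => n n1 nmin.
exists n, ((2 ^+ n)^-1 `^ beta^-1).
have e0 : (0 : R) < 2 ^+ n by rewrite exprn_gt0.
have sb : ((2 ^+ n)^-1 `^ beta^-1) `^ beta = (2 ^+ n)^-1.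
  by rewrite -powRrM mulVf ?gt_eqF// powRr1// invr_ge0 ltW.
have rn : r `^ beta <= (2 ^+ n)^-1.
  rewrite -[leRHS]mul1r ler_pdivlMr// mulrC.
  case: n {n1 e0 sb} nmin => [|n] nmin.
    rewrite expr0 mul1r.
    have r01 : 0 < r <= 1 by rewrite r0 ltW.
    by have := ger_powR r01 (ltW beta_gt0); rewrite powRr0.
  by rewrite leNgt; apply/negP => /nmin; rewrite ltnn.
split => //; last first.
  rewrite sb -[leLHS]mul1r ler_pdivrMr// ltW//.
  by move: n1; rewrite exprS -mulrA [_ ^+ _ * _]mulrC mulrA.
rewrite leNgt; apply/negP => sr.
have : (2 ^+ n)^-1 < r `^ beta.
  by rewrite -sb gt0_ltr_powR ?nnegrE ?powR_ge0// ltW.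
by rewrite ltNge rn.
Qed.

(** On the ball of radius r <= s the kernel q_s is at least s^-alpha [Phi1 1], and the ball has
    measure at least c0 r^alpha. The averaged differences are thus controlled by the energy at the
    dyadic time s^beta. *)
Lemma besov_kernel_op (f : borel M -> R) : f \in Lfun mu 2%:E ->
  (besov_energy mu (beta / 2) (kernel_op mu (p 1) f) < +oo)%E.
Proof.
move=> fL; set u := kernel_op mu (p 1) f.
have uL : u \in Lfun mu 2%:E by apply: kernel_op_Lfun => //; exact: p_markov.
have [c0 c00 vol] := ball_measure_ge beta_gt0 Phi1_1 Phi2_ge0 Phi1_mono
  Phi2_mono q_ge0 q_int1 q_bounds dyadic_sum.
pose N := dot mu f f; have N0 : 0 <= N := dot_ge0 _ _.
have cP0 : 0 < c0 * Phi1 1 by rewrite mulr_gt0.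
(* Here 2 bounds (s/r)^beta and 2^(alpha/beta) bounds (s/r)^alpha, so the bound does not depend on
   r. *)
apply: (@le_lt_trans _ _
    (2 * 2 `^ (alpha / beta) * (2 * N) / (c0 * Phi1 1))%:E); last exact: ltry.
apply: ge_ereal_sup => _ [r /= + <-]; rewrite in_itv /= => /andP[r0 r1].
have -> : 2 * (beta / 2) = beta by field.
have [n [s [sb rs sb2]]] := dyadic_time r0 r1.
have s0 : 0 < s := lt_le_trans r0 rs.
have sa0 : 0 < s `^ alpha by rewrite powR_gt0.
have ra0 : 0 < r `^ alpha by rewrite powR_gt0.
have rb0 : 0 < r `^ beta by rewrite powR_gt0.
pose C := (c0 * r `^ alpha)^-1 * (s `^ alpha / Phi1 1).
have C1 : 0 < (c0 * r `^ alpha)^-1 by rewrite invr_gt0 mulr_gt0.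
have C2 : 0 < s `^ alpha / Phi1 1 by rewrite divr_gt0.
have C0 : 0 < C by rewrite mulr_gt0.
have mu' : measurable_fun setT u := Lfun2_measurable uL.
pose sqd x y := (u x - u y) ^+ 2.
have mq : measurable_fun setT
    (fun z : borel M * borel M => (q s z.1 z.2 * sqd z.1 z.2)%:E).
  apply/measurable_EFinP/measurable_funM.
    exact: markov_measurable (q_markov s0).
  by apply: measurable_funX; apply: measurable_funB; exact: measurableT_comp.
have q0 z : (0 <= (q s z.1 z.2 * sqd z.1 z.2)%:E)%E.
  by rewrite lee_fin mulr_ge0 ?q_ge0 ?sqr_ge0.
have mF : measurable_fun setT
    (fun x : borel M => \int[mu]_y (q s x y * sqd x y)%:E)%E.
  exact: (measurable_fun_fubini_tonelli_F _ mq q0).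
have F0 x : (0 <= \int[mu]_y (q s x y * sqd x y)%:E)%E.
  by apply: integral_ge0 => y _; exact: (q0 (x, y)).
have key : (\int[mu]_x ((mu (ball (x : M) r))^-1 *
    \int[mu]_(y in ball (x : M) r) (`|u y - u x| ^+ 2)%:E) <=
    (C * (2 * energy mu p (2 ^+ n)^-1 u))%:E)%E.
  rewrite EFinM -sb -(kernel_energyE (q_markov s0) uL).
  rewrite -(ge0_integralZl_EFin mu measurableT (fun x _ => F0 x) mF (ltW C0)).
  apply: ae_le_lower_integral.
  - move=> x _; rewrite mule_ge0 ?inve_ge0//; apply: integral_ge0 => y _.
    by rewrite lee_fin exprn_ge0.
  - by move=> x _; rewrite mule_ge0 ?lee_fin ?(ltW C0).
  have volr := vol _ r0; have near := q_lower_ball Phi1_mono q_bounds s0 rs.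
  apply: filterS2 volr near => x xvol xq _.
  have mqx : measurable_fun setT (fun y : borel M => (q s x y * sqd x y)%:E).
    exact: measurableT_comp mq (pair1_measurable x).
  rewrite EFinM -muleA; apply: lee_pmul.
  - by rewrite inve_ge0.
  - by apply: integral_ge0 => y _; rewrite lee_fin exprn_ge0.
  - have -> : ((c0 * r `^ alpha)^-1%:E = (c0 * r `^ alpha)%:E^-1)%E.
      by rewrite inver gt_eqF// mulr_gt0.
    by rewrite lee_pV2 ?inE ?lee_fin ?mulr_ge0 ?(ltW ra0) ?(ltW c00).
  rewrite -ge0_integralZl_EFin//; last 2 first.
  - by move=> y _; exact: (q0 (x, y)).
  - exact: ltW.
  rewrite [leLHS]integral_mkcond; apply: ae_le_lower_integral.
  - by move=> y _; rewrite erestrict_ge0// => z _; rewrite lee_fin exprn_ge0.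
  - by move=> y _; apply: mule_ge0 (q0 (x, y)); rewrite lee_fin ltW.
  apply: filterS xq => y xyq _; rewrite patchE.
  case: ifPn => [/set_mem/xyq sq|_]; last first.
    by apply: mule_ge0 (q0 (x, y)); rewrite lee_fin ltW.
  rewrite -EFinM lee_fin real_normK ?num_real// -sqrrN opprB mulrA.
  rewrite -[leLHS]mul1r ler_wpM2r ?sqr_ge0// -ler_pdivrMl// mulr1.
  by rewrite invfM invrK.
have En := energy_smoothing p_markov p_semigroup n fL.
have {key} key := le_trans key (_ : _ <= (C * (2 * ((2 ^+ n)^-1 * N)))%:E)%E.
apply: (@le_trans _ _
    ((r `^ (- beta))%:E * (C * (2 * ((2 ^+ n)^-1 * N)))%:E)%E).
  apply: lee_wpmul2l; first by rewrite lee_fin powR_ge0.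
  by apply: key; rewrite lee_fin ler_pM2l// ler_pM2l.
rewrite -EFinM lee_fin powRN -sb.
have -> : (r `^ beta)^-1 * (C * (2 * (s `^ beta * N))) =
    (s `^ beta / r `^ beta) * (s `^ alpha / r `^ alpha) * (2 * N) /
    (c0 * Phi1 1).
  by rewrite /C; field; rewrite !gt_eqF.
rewrite ler_pM2r ?invr_gt0// ler_wpM2r ?mulr_ge0//.
have sr2 : s `^ beta / r `^ beta <= 2 by rewrite ler_pdivrMr.
apply: ler_pM => //; rewrite ?divr_ge0 ?powR_ge0//.
have rE : r `^ alpha = (r `^ beta) `^ (alpha / beta).
  by rewrite -powRrM mulrCA divff ?mulr1// gt_eqF.
have sE : s `^ alpha = (s `^ beta) `^ (alpha / beta).
  by rewrite -powRrM mulrCA divff ?mulr1// gt_eqF.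
rewrite ler_pdivrMr// rE sE -powRM ?(ltW rb0)//.
have ab0 : 0 <= alpha / beta by rewrite divr_ge0 ?ltW.
by apply: ge0_ler_powR; rewrite ?nnegrE ?powR_ge0 ?(mulr_ge0 _ (ltW rb0)).
Qed.

Lemma disjoint_annuli : exists A : nat -> set (borel M),
  [/\ forall k, measurable (A k), forall k, (0 < mu (A k) < +oo)%E &
      forall j k, j <> k -> A j `&` A k = set0].
Proof.
have [c0 c00 vol] := ball_measure_ge beta_gt0 Phi1_1 Phi2_ge0 Phi1_mono
  Phi2_mono q_ge0 q_int1 q_bounds dyadic_sum.
have volle := ball_measure_le Phi1_1 Phi1_mono q_ge0 q_int1 q_bounds.
have cP0 : 0 < (c0 * Phi1 1)^-1 by rewrite invr_gt0 mulr_gt0.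
pose b : R := 1 + (c0 * Phi1 1)^-1.
have b1 : 1 <= b by rewrite lerDl ltW.
(* Enlarging the radius by Q must outweigh the gap between the two volume constants: c0 Q^alpha = c0
   + 1 / [Phi1 1] exceeds 1 / [Phi1 1], so consecutive balls differ by a set of positive measure. *)
have [Q Q1 Qa] : exists2 Q : R, 1 <= Q & Q `^ alpha = b.
  exists (b `^ alpha^-1); last first.
    by rewrite -powRrM mulVf ?gt_eqF// powRr1// (le_trans ler01).
  have a0 : 0 <= alpha^-1 by rewrite invr_ge0 ltW.
  by have := ler_powR b1 a0; rewrite powRr0.
have Qk0 k : 0 < Q ^+ k by rewrite exprn_gt0// (lt_le_trans ltr01).
have [x [xge xle]] := mu_exists mu_neq0 (filterI
  (ae_foralln (fun k => vol _ (Qk0 k)))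
  (ae_foralln (fun k => volle _ (Qk0 k)))).
pose B k : set (borel M) := ball (x : M) (Q ^+ k).
have mB k : measurable (B k) by exact: measurable_metric_ball.
have BS j k : (j <= k)%N -> B j `<=` B k.
  by move=> jk; apply: le_ball; exact: ler_weXn2l.
have Boo k : (mu (B k) < +oo)%E by exact: le_lt_trans (xle k) (ltry _).
have disj j k : (j < k)%N -> (B j.+1 `\` B j) `&` (B k.+1 `\` B k) = set0.
  by move=> jk; apply/seteqP; split => // y [[/(BS _ _ jk) By _] [_]]; apply.
exists (fun k => B k.+1 `\` B k); split.
- by move=> k; exact: measurableD.
- move=> k; apply/andP; split; last first.
    apply: le_lt_trans (Boo k.+1); apply: le_measure; rewrite ?inE//.
    exact: measurableD.
  rewrite lt_neqAle measure_ge0 andbT eq_sym; apply/eqP => A0.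
  have : (mu (B k.+1) <= mu (B k) + mu (B k.+1 `\` B k))%E.
    rewrite -[in leLHS](setDUK (BS _ _ (leqnSn k))).
    by apply: measureU2 => //; exact: measurableD.
  rewrite A0 adde0 leNgt => /negP; apply.
  apply: (le_lt_trans (xle k)); apply: (lt_le_trans _ (xge k.+1)).
  rewrite lte_fin exprSr powRM ?(ltW (Qk0 k)) ?(le_trans ler01)// Qa.
  rewrite mulrCA ltr_pM2l ?powR_gt0// /b mulrDr mulr1 invfM mulrA.
  rewrite divff ?gt_eqF//.
  by rewrite mul1r ltrDr.
- move=> j k jk; have [jk'|jk'|//] := ltngtP j k; first exact: disj.
  by rewrite setIC disj.
Qed.

Hypothesis p_approx : forall f : L2 mu,
  ('N[mu]_2%:E[EFin \o (fun x => heat_op mu (p t) f x - f x)%R])%E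
    @[t --> 0^'+] --> 0%E.

(** If P_1 f = 0 then P_t f = 0 at all times t = 2^-n, so |P_t f - f| = |f| there, while the
    approximation of the identity sends it to 0. *)
Lemma kernel_op_injective (f : borel M -> R) : f \in Lfun mu 2%:E ->
  kernel_op mu (p 1) f = cst 0 %[ae mu] -> f = cst 0 %[ae mu].
Proof.
move=> fL f0; have mf := Lfun2_measurable fL.
have N0 : ('N[mu]_2%:E[EFin \o f] = 0)%E.
  apply/eqP; apply: contrapT => /negP N_neq0.
  have Ngt0 : (0 < 'N[mu]_2%:E[EFin \o f])%E by rewrite lt0e N_neq0 Lnorm_ge0.
  have := p_approx (Lfun_Sub (lee1n 2) fL) (open_ereal_lt' Ngt0).
  move=> [e /= e0 He].
  have [n ne] : exists n, (2 ^+ n)^-1 < e.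
    exists (Num.bound e^-1); rewrite invf_plt ?posrE ?exprn_gt0//.
    apply: lt_le_trans (archi_boundP _) _; first by rewrite invr_ge0 ltW.
    by rewrite -natrX ler_nat ltnW// ltn_expl.
  have n0 : (0 : R) < (2 ^+ n)^-1 by rewrite invr_gt0 exprn_gt0.
  have := He (2 ^+ n)^-1; rewrite /= sub0r normrN ger0_norm ?(ltW n0)//.
  move=> /(_ ne n0); rewrite ltNge => /negP; apply.
  have Pn := semigroup_op_eq0 p_markov p_semigroup n fL f0.
  suff -> : ('N[mu]_2%:E[EFin \o
      (fun x => (heat_op mu (p (2 ^+ n)^-1) f x - f x)%R)] =
      'N[mu]_2%:E[EFin \o f])%E by [].
  rewrite Lnorm.unlock /=; congr (_ `^ _)%E.
  have mP : measurable_fun setT (kernel_op mu (p (2 ^+ n)^-1) f).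
    exact: (kernel_op_measurable (p_markov n0)).
  have mN (g : borel M -> R) : measurable_fun setT g ->
      measurable_fun setT (fun x => `|(g x)%:E| `^ 2)%E.
    move=> mg; apply: (measurableT_comp (measurable_poweR _)).
    by apply: measurableT_comp => //; exact/measurable_EFinP.
  have -> : heat_op mu (p (2 ^+ n)^-1) f = kernel_op mu (p (2 ^+ n)^-1) f.
    by apply/funext => x; rewrite kernel_opE.
  apply: ae_eq_integral => //.
  - by apply: (mN (fun x => _ - _)); exact: measurable_funB.
  - exact: mN.
  by apply: filterS Pn => x /(_ I) -> _ /=; rewrite sub0r normrN.
have mEf : measurable_fun setT (EFin \o f) by exact/measurable_EFinP.
have := Lnorm_eq0_eq0 mEf _ N0; rewrite lte_fin ltr0n => /(_ isT).
by apply: filterS => x /(_ I) [].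
Qed.

(** The independent family consists of the images under P_1 of the indicators of disjoint annuli;
    injectivity brings a linear relation back to the indicators. *)
Lemma besov_infinite_dim : ae_infinite_dim (besov mu (beta / 2)).
Proof.
move=> n; have [A [mA A0 disjA]] := disjoint_annuli.
have p1 := p_markov ltr01.
pose f (i : 'I_n) : borel M -> R := \1_(A i).
have fL i : f i \in Lfun mu 2%:E.
  apply/Lfun2P; split; first exact: measurable_indic.
  under eq_integral do rewrite /f indicE -natrX expnS mulnb andbb -indicE.
  rewrite integral_indic// setIT.
  by have /andP[] := A0 i.
pose u i : L2 mu := Lfun_Sub (lee1n 2) (kernel_op_Lfun p1 (fL i)).
exists u; split=> [i|c cu i]; first exact: besov_kernel_op.
pose g (x : borel M) : R := \sum_(j <- index_enum 'I_n) c j * f j x.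
have gL : g \in Lfun mu 2%:E by exact: Lfun2_sum.
have sumE (s : seq 'I_n) : ((\sum_(j <- s) c j *: u j : L2 mu) : M -> R) =
    (fun x => \sum_(j <- s) c j * kernel_op mu (p 1) (f j) x).
  apply/funext => x; elim: s => [|j s ih]; first by rewrite !big_nil.
  by rewrite !big_cons -ih.
have Pg : kernel_op mu (p 1) g = cst 0 %[ae mu].
  apply: filterS2 cu (kernel_op_sum p1 (index_enum _) c fL) => x cux -> _.
  exact: etrans (esym (congr1 (fun h => h x) (sumE _))) (cux I).
have g0 := kernel_op_injective gL Pg.
(* On the annulus [A i] the combination [g] equals [c i]; were this nonzero, [A i] would be a null
   set. *)
apply: contrapT => ci0; have /andP[+ _] := A0 i.
rewrite lt0e => /andP[/eqP + _]; apply; apply: measure_negligible => //.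
apply: negligibleS g0 => x Aix /= /(_ I).
rewrite /g (bigD1 i)//= big1 => [|j ji].
  by rewrite /f indicE mem_set// mulr1 addr0.
rewrite /f indicE memNset ?mulr0// => Ajx.
have : (A i `&` A j) x by split.
by rewrite disjA// => /ord_inj ij; rewrite ij eqxx in ji.
Qed.

End heat_semigroup.

(** * From the kernel hypotheses to the theorem *)

Lemma sigma_finite_measure_exists d (T : measurableType d) (R : realType)
    (mu : {measure set T -> \bar R}) : sigma_finite setT mu ->
  exists nu : {sigma_finite_measure set T -> \bar R},
    mu = (nu : {measure set T -> \bar R}).
Proof.
move=> sf.
pose mS := isSFinite.Build _ _ _ _ (sfinite_measure_sigma_finite sf).
pose mF := isSigmaFinite.Build _ _ _ _ sf.
pose nu := HB.pack_for (sigma_finite_measure T R) (Measure.sort mu) mS mF.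
by exists nu; exact: eq_measure.
Qed.

Theorem theorem2 (R : realType) (M : pmetricType R)
    (mu : {measure set (borel M) -> \bar R})
    (mu_neq0 : mu [set: M] <> 0%E)
    (p : R -> M -> M -> R) (hp : heat_kernel mu p)
    (alpha beta : R) (alpha_gt0 : 0 < alpha) (beta_gt0 : 0 < beta)
    (Phi1 Phi2 : R -> R)
    (Phi1_ge0 : forall s : R, 0 <= s -> 0 <= Phi1 s)
    (Phi2_ge0 : forall s : R, 0 <= s -> 0 <= Phi2 s)
    (Phi1_mono : forall s t : R, 0 <= s -> s <= t -> Phi1 t <= Phi1 s)
    (Phi2_mono : forall s t : R, 0 <= s -> s <= t -> Phi2 t <= Phi2 s)
    (hbounds : forall t : R, 0 < t -> ae2 mu (fun x y =>
       1 / t `^ (alpha / beta) * Phi1 (mdist x y / t `^ (1 / beta)) <= p t x y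
       /\
       p t x y <= 1 / t `^ (alpha / beta) * Phi2 (mdist x y / t `^ (1 / beta))))
    (Phi1_1 : 0 < Phi1 1)
    (Phi2_int : (\int[@lebesgue_measure R]_(s in `]0%R, +oo[)
       (s `^ (alpha + beta) * Phi2 s / s)%:E < +oo)%E) :
  (forall sigma : R, beta / 2 < sigma ->
     forall u : L2 mu, besov mu sigma u <-> u = cst 0 %[ae mu]) /\
  beta%:E = critical_exponent mu.
Proof.
have pb0 r : 0 < r -> 0 < r `^ beta by exact: powR_gt0.
have q_ge0 (r : R) x y : 0 < r -> 0 <= p (r `^ beta) x y.
  by move=> r0; exact: hk_ge0 hp _ (pb0 r r0) x y.
have q_int1 (r : R) : 0 < r ->
    {ae mu, forall x : borel M, \int[mu]_y (p (r `^ beta) x y)%:E = 1}%E.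
  by move=> r0; exact: hk_unit hp _ (pb0 r r0).
(* At time t = r^beta the powers t^(alpha/beta) and t^(1/beta) become r^alpha and r. *)
have q_bounds (r : R) : 0 < r ->
    {ae mu, forall x : borel M, {ae mu, forall y : borel M,
      (r `^ alpha)^-1 * Phi1 (mdist (x : M) y / r) <= p (r `^ beta) x y /\
      p (r `^ beta) x y <= (r `^ alpha)^-1 * Phi2 (mdist (x : M) y / r)}}.
  move=> r0; have := hbounds _ (pb0 r r0).
  rewrite -!powRrM !mulrA [beta * alpha]mulrC mulfK ?gt_eqF// mulr1.
  rewrite divff ?gt_eqF//.
  by rewrite powRr1 ?ltW// !div1r.
have dyadic_sum := dyadic_integral_test
  (addr_ge0 (ltW alpha_gt0) (ltW beta_gt0)) Phi2_ge0 Phi2_mono Phi2_int.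
(* From here on the measure carries its sigma-finiteness, on which the Tonelli and Fubini arguments
   rest. *)
have [nu mu_nu] := sigma_finite_measure_exists
  (mu_sigma_finite Phi1_1 Phi1_mono q_ge0 q_int1 q_bounds mu_neq0).
subst mu.
have p_markov t : 0 < t -> @symmetric_markov _ (borel M) _ nu (p t).
  move=> t0; split; first exact: hk_measurable hp _ t0.
  - exact: hk_ge0 hp _ t0.
  - exact: hk_sym hp _ t0.
  - exact: hk_unit hp _ t0.
have p_semigroup := hk_semigroup hp.
have vanish sigma : beta / 2 < sigma -> forall u : L2 nu,
    besov nu sigma u -> u = cst 0 %[ae nu].
  move=> sigma_gt u uW.
  exact: (besov_eq0 alpha_gt0 beta_gt0 Phi1_1 Phi2_ge0 Phi1_mono Phi2_mono
    p_markov p_semigroup mu_neq0 q_bounds dyadic_sum (LfunP u) sigma_gt uW).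
have infinite := besov_infinite_dim alpha_gt0 beta_gt0 Phi1_1 Phi2_ge0 Phi1_mono
  Phi2_mono p_markov p_semigroup mu_neq0 q_bounds dyadic_sum (hk_approx_id hp).
split.
  move=> sigma sigma_gt u; split; first exact: vanish.
  move=> u0; apply: le_lt_trans (ltry 0); apply: ge_ereal_sup => _ [r _ <-].
  set W := (X in (_ * X)%E).
  suff -> : W = 0%E by rewrite mule0.
  have B0 (x : borel M) :
      (0 <= \int[nu]_(y in ball (x : M) r) (`|u y - u x| ^+ 2)%:E)%E.
    by apply: integral_ge0 => y _; rewrite lee_fin exprn_ge0.
  have W0 (x : borel M) : (0 <= (nu (ball (x : M) r))^-1 *
      \int[nu]_(y in ball (x : M) r) (`|u y - u x| ^+ 2)%:E)%E.
    by rewrite mule_ge0 ?inve_ge0.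
  apply/eqP; rewrite eq_le; apply/andP; split; last first.
    by apply: integral_ge0 => x _; exact: W0.
  apply: (@le_trans _ _ (\int[nu]_x cst 0 x)%E); last by rewrite integral0.
  apply: ae_le_lower_integral => [x _|//|]; first exact: W0.
  apply: filterS (u0) => x /(_ I) ux _.
  rewrite [X in (_ * X)%E](_ : _ = 0%E) ?mule0//.
  apply/eqP; rewrite eq_le B0 andbT.
  apply: (@le_trans _ _ (\int[nu]_(y in ball (x : M) r) cst 0 y)%E).
    2: by rewrite integral0.
  apply: ae_le_lower_integral => [y _|//|]; first by rewrite lee_fin exprn_ge0.
  apply: filterS u0 => y /(_ I) uy _.
  by rewrite ux uy subrr normr0 expr0n.
rewrite /critical_exponent.
have -> : beta%:E = (2%:E * (beta / 2)%:E)%E.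
  by rewrite -EFinM mulrC divfK.
congr (_ * _)%E; apply/eqP; rewrite eq_le; apply/andP; split.
  apply: ereal_sup_ubound; exists (beta / 2) => //.
  by split; [rewrite divr_gt0|].
apply: ge_ereal_sup => _ [sigma [_ sigma_inf] <-].
rewrite lee_fin leNgt; apply/negP => /vanish sigma_vanish.
(* Above beta/2 even a family of length one fails to be independent, since its only member vanishes
   almost everywhere. *)
have [u [uW u_free]] := sigma_inf 1.
suff : (1 : R) = 0 by move/eqP; rewrite oner_eq0.
apply: (u_free (fun=> 1) _ ord0); rewrite big_ord1 scale1r.
exact: sigma_vanish (uW ord0).
Qed.
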